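(* Let $\mathcal{A}=(N,\beta,\theta)$ be a stacky hyperplane arrangement with Lawrence stacky fan $\mathbf{\Sigma_\theta}=(N_L,\Sigma_\theta,\beta_L)$. Let $(v_1,\sigma_1),(v_2,\sigma_2),(v_3,\sigma_3)\in Box(\Delta_\beta)$ be such that there is a minimal cone $\sigma=\sigma(\overline v_1,\overline v_2,\overline v_3)$ in $\Delta_\beta$ containing $\sigma_1,\sigma_2,\sigma_3$ and $\overline v_1+\overline v_2+\overline v_3=\sum_{\rho_i\subseteq\sigma}a_i\overline b_i$ with each $a_i\in\{1,2\}$. Let $\sigma$ be generated by $\overline b_{i_1},\dots,\overline b_{i_s}$, let $l$ be the number of rays in $link(\sigma)$, and let $\overline b_{j_1},\dots,\overline b_{j_{m-l-s}}$ be the remaining vectors (those not in $\sigma\cup link(\sigma)$). Let $\sigma_\theta$ be a cone of $\Sigma_\theta$ generated by $\overline b_{L,i_1},\dots,\overline b_{L,i_s},\overline b'_{L,i_1},\dots,\overline b'_{L,i_s}$ together with $m-l-s$ of the vectors $\overline b_{L,j_1},\dots,\overline b_{L,j_{m-l-s}},\overline b'_{L,j_1},\dots,\overline b'_{L,j_{m-l-s}}$. Then the quotient toric Deligne–Mumford stack $\mathcal{X}(\mathbf{\Sigma_{\theta}}/\sigma_{\theta})$ is also a Lawrence toric Deligne–Mumford stack.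
   Context: Everything is over $\mathbb{C}$. For a finitely generated abelian group $N$, a bar denotes passage to the quotient by torsion, and $(-)^\star=\mathrm{Hom}_{\mathbb{Z}}(-,\mathbb{Z})$. Gale dual: for $\beta:\mathbb{Z}^m\to N$ with finite cokernel ($N$ of rank $d$), choose a free resolution $0\to\mathbb{Z}^r\xrightarrow{Q}\mathbb{Z}^{d+r}\to N\to0$ and a lift $B$ of $\beta$; $DG(\beta)=\mathrm{coker}([B\,Q]^\star:(\mathbb{Z}^{d+r})^\star\to(\mathbb{Z}^{m+r})^\star)$, with $\beta^\vee:\mathbb{Z}^m\cong(\mathbb{Z}^m)^\star\to DG(\beta)$ the induced map. A stacky hyperplane arrangement $(N,\beta,\theta)$: $N$ finitely generated abelian of rank $d$, $\beta:\mathbb{Z}^m\to N$ with finite cokernel given by nontorsion elements $b_1,\dots,b_m$, and $\theta\in DG(\beta)$ generic, i.e. on no hyperplane of $DG(\beta)_{\mathbb{R}}$ spanned by vectors among the $a_i$, where $\beta^\vee=(a_1,\dots,a_m)$. Lawrence stacky fan $\mathbf{\Sigma_\theta}=(N_L,\Sigma_\theta,\beta_L)$: $\beta_L:\mathbb{Z}^{2m}\to N_L$ is the Gale dual of $(\beta^\vee,-\beta^\vee):\mathbb{Z}^m\oplus\mathbb{Z}^m\to DG(\beta)$, given by vectors $b_{L,1},\dots,b_{L,m},b'_{L,1},\dots,b'_{L,m}$ ($\overline b_{L,i},\overline b'_{L,i}$ are the Lawrence lifting of $\overline b_i$). For each $C=\{\overline a_{i_1},\dots,\overline a_{i_{m-d}}\}$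 that is a basis of $DG(\beta)_{\mathbb{R}}$, write $\overline\theta=\sum_j\lambda_j\overline a_{i_j}$ and put $\sigma(C,\theta)=\{\overline b_{L,i_j}:\lambda_j>0\}\sqcup\{\overline b'_{L,i_j}:\lambda_j<0\}$. The maximal cones of $\Sigma_\theta$ are generated by the complements of the sets $\sigma(C,\theta)$ in $\{\overline b_{L,1},\dots,\overline b_{L,m},\overline b'_{L,1},\dots,\overline b'_{L,m}\}$. A Lawrence toric DM stack is the toric DM stack $\mathcal{X}(\mathbf{\Sigma_\theta})$ of the Lawrence stacky fan of some stacky hyperplane arrangement. Toric DM stack of a stacky fan $(N,\Sigma,\beta)$ with $\beta:\mathbb{Z}^n\to N$ given by one vector $b_i$ for each ray of the simplicial fan $\Sigma$: the quotient $[(\mathbb{C}^n\setminus V(J_\Sigma))/G]$, $J_\Sigma$ the irrelevant ideal, $G=\mathrm{Hom}_{\mathbb{Z}}(DG(\beta),\mathbb{C}^* )$ acting via the map $G\to(\mathbb{C}^* )^n$ obtained from $\beta^\vee$. Quotient stacky fan: for a cone $\tau$ of a stacky fan $\mathbf{\Sigma}=(N,\Sigma,\beta)$, let $N_\tau\subset N$ be the subgroup generated by the $b_i$ with $\rho_i\subseteq\tau$, $N(\tau)=N/N_\tau$, $\Sigma/\tau$ the quotient fan, and $link(\tau)=\{\tau':\tau+\tau'\in\Sigma,\ \tau\cap\tau'=0\}$; $\beta(\tau)$ is the map to $N(\tau)$ given by the images of the $b_i$ with $\rho_i$ a ray of $link(\tau)$. Then $\mathbf{\Sigma}/\tau=(N(\tau),\Sigma/\tau,\beta(\tau))$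 and $\mathcal{X}(\mathbf{\Sigma}/\tau)$ is its toric DM stack. Multi-fan $\Delta_\beta$: its cones are indexed by the subsets $F\subseteq\{1,\dots,m\}$ such that $\{\overline b_i\}_{i\in F}$ is linearly independent, the cone of $F$ being the one generated by $\{\overline b_i\}_{i\in F}$ (cones with different index sets are regarded as different, even if their images in $\overline N$ overlap); $\rho_i$ is the ray of $\overline b_i$. $link(\sigma)$ for $\sigma$ with index set $F$ has as rays those $\rho_i$, $i\notin F$, such that $F\cup\{i\}$ indexes a cone. $Box(\Delta_\beta)$ is the set of pairs $(v,\sigma)$, $\sigma$ a cone of $\Delta_\beta$ and $v\in N$ with $\overline v=\sum_{\rho_i\subseteq\sigma}\alpha_i\overline b_i$, all $0<\alpha_i<1$. *)

(* Defs.v *)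
From HB Require Import structures.
From mathcomp Require Import all_boot all_order all_algebra.
From mathcomp Require Import ring_quotient.
From mathcomp Require Import all_classical all_reals.
From mathcomp Require Import complex.

Set Implicit Arguments.
Unset Strict Implicit.
Unset Printing Implicit Defensive.

Import Order.TTheory GRing.Theory Num.Theory.
Local Open Scope ring_scope.

(** * Abelian groups, quotients and realification

    A homomorphism Z^I -> N is given by the images b : I -> N of the basis
    vectors; I is a finite type, so that the index sets {1..m}, {1..m} + {1..m}
    and the set of rays of a link are all treated alike. *)

Section Subgroup.
Variables (N : zmodType) (I : finType) (b : I -> N) (F : {set I}).

Definition gen_mem : {pred N} :=
  fun x => `[< exists c : I -> int, x = \sum_(i in F) b i *~ c i >].

Lemma gen_mem_zmod_closed : zmod_closed gen_mem.
Proof.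
split=> [|x y /asboolP[c ->] /asboolP[c' ->]]; apply/asboolP.
  by exists (fun=> 0); rewrite big1.
exists (fun i => c i - c' i); rewrite -sumrB.
by apply: eq_bigr => i _; rewrite mulrzBr.
Qed.

HB.instance Definition _ :=
  GRing.isZmodClosed.Build N gen_mem gen_mem_zmod_closed.

(** The quotient of N by the subgroup generated by the b i, i \in F. *)
Definition quotg : zmodType := Quotient.quot gen_mem.

Definition to_quotg (x : N) : quotg := (\pi_(Quotient.quot gen_mem) x)%qT.

End Subgroup.

Definition nontorsion (N : zmodType) (x : N) :=
  forall k : nat, (0 < k)%N -> x *+ k <> 0.

Definition finite_coker (N : zmodType) (I : finType) (b : I -> N) :=
  finite_set [set: quotg b [set: I]%SET].

Section Realification.
Variable R : realType.

(** For N finitely generated, N_R = N (x) R is the R-span of the image of N in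
    the space of functions N^* -> R, where N^* = Hom(N, Z); the image [bar x] of
    x in N_R is evaluation at x, and it vanishes exactly when x is torsion. *)
Definition bar (N : zmodType) (x : N) : {additive N -> int} -> R^o :=
  fun f => (f x)%:~R.

Definition rspan (V : lmodType R) (S : set V) : set V := fun x =>
  exists n (c : 'I_n -> R) (v : 'I_n -> V),
    (forall i, S (v i)) /\ x = \sum_(i < n) c i *: v i.

Definition real_space (N : zmodType) := rspan (range (@bar N)).
Arguments real_space N : clear implicits.

Section Family.
Variables (N : zmodType) (I : finType) (b : I -> N) (F : {set I}).

Definition family_span :=
  rspan (fun v => exists2 i, i \in F & v = bar (b i)).

Definition lin_indep := forall lam : I -> R,
  \sum_(i in F) lam i *: bar (b i) = 0 -> forall i, i \in F -> lam i = 0.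

Definition is_basis := lin_indep /\ family_span = real_space N.

End Family.

Definition is_hyperplane (V : lmodType R) (W H : set V) :=
  [/\ H `<=` W, H <> W & exists2 x, W x & rspan (H `|` [set x]) = W]%classic.

End Realification.
Arguments bar R {N} x.
Arguments real_space R N : clear implicits.
Arguments family_span R {N I} b F.
Arguments lin_indep R {N I} b F.
Arguments is_basis R {N I} b F.

(** * Gale duality *)

(** The choices entering the definition of the Gale dual of b : Z^I -> N: a free
    resolution 0 -> Z^r -Q-> Z^p -eps-> N -> 0 and a lift B : Z^I -> Z^p of b.
    Here p = d + r with d the rank of N. In particular N is finitely generated. *)
Record resolution (N : zmodType) (I : finType) (b : I -> N) := Resolution {
  res_p : nat;
  res_r : nat;
  res_eps : {additive {ffun 'I_res_p -> int} -> N};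
  res_Q : 'I_res_r -> {ffun 'I_res_p -> int};
  res_B : I -> {ffun 'I_res_p -> int};
  res_eps_surj : forall x : N, exists u, res_eps u = x;
  res_Q_inj : forall c : 'I_res_r -> int,
    \sum_k res_Q k *~ c k = 0 -> forall k, c k = 0;
  res_exact : forall u : {ffun 'I_res_p -> int},
    res_eps u = 0 <-> exists c : 'I_res_r -> int, u = \sum_k res_Q k *~ c k;
  res_lift : forall i, res_eps (res_B i) = b i
}.
Arguments res_Q {N I b} r k.

Section GaleDual.
Variables (N : zmodType) (I : finType) (b : I -> N) (res : resolution b).

(** The image under [B Q]^* : (Z^p)^* -> (Z^(I + r))^* of the j-th vector of the
    dual basis of (Z^p)^*. *)
Definition dual_BQ (j : 'I_(res_p res)) : {ffun I + 'I_(res_r res) -> int} :=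
  [ffun z => match z with inl i => res_B res i j | inr k => res_Q res k j end].

Definition DG : zmodType := quotg dual_BQ [set: 'I_(res_p res)]%SET.

Definition gale_dual (i : I) : DG :=
  to_quotg dual_BQ [set: 'I_(res_p res)]%SET
    [ffun z => (z == inl i)%:R : int].

End GaleDual.

(** * Stacky hyperplane arrangements and the multi-fan *)

Section Generic.
Variables (R : realType) (D : zmodType) (I : finType) (a : I -> D).

Definition generic (theta : D) := forall S : {set I},
  is_hyperplane (real_space R D) (family_span R a S) ->
  ~ family_span R a S (bar R theta).

End Generic.

Record arrangement (R : realType) := Arrangement {
  arr_N : zmodType;
  arr_I : finType;
  arr_b : arr_I -> arr_N;
  arr_res : resolution arr_b;
  arr_theta : DG arr_res;
  arr_finite_coker : finite_coker arr_b;
  arr_nontorsion : forall i, nontorsion (arr_b i);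
  arr_generic : generic R (gale_dual arr_res) arr_theta
}.
Arguments arr_b {R} a _.

Section MultiFan.
Variables (R : realType) (N : zmodType) (I : finType) (b : I -> N).

(** Cones of the multi-fan are represented by their index sets. *)
Definition mf_cone (F : {set I}) := lin_indep R b F.

Definition mf_link (F : {set I}) : {set I} :=
  [set i | (i \notin F) && `[< mf_cone (i |: F) >]]%SET.

Definition in_box (v : N) (F : {set I}) := mf_cone F /\
  exists alpha : I -> R, (forall i, i \in F -> 0 < alpha i < 1) /\
    bar R v = \sum_(i in F) alpha i *: bar R (b i).

Definition mf_minimal (F1 F2 F3 F : {set I}) :=
  let contains G := [/\ mf_cone G, F1 \subset G, F2 \subset G & F3 \subset G] in
  contains F /\ forall G, contains G -> G \subset F -> G = F.

End MultiFan.

(** * Stacky fans *)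

(** A stacky fan (N, Sigma, b), with b i spanning the ray rho_i of Sigma. As Sigma
    is simplicial, a cone is determined by the set of the rays it contains, and
    [sf_cone K] says that the cone generated by the b i, i \in K, is in Sigma. *)
Record stacky_fan := StackyFan {
  sf_N : zmodType;
  sf_I : finType;
  sf_b : sf_I -> sf_N;
  sf_cone : {set sf_I} -> Prop
}.
Arguments sf_b s _ : clear implicits.
Arguments sf_cone s _ : clear implicits.

Section QuotientFan.
Variables (Sg : stacky_fan) (tau : {set sf_I Sg}).

(** tau + tau' \in Sigma and tau :&: tau' = 0, on sets of rays. *)
Definition sf_link (tau' : {set sf_I Sg}) :=
  sf_cone Sg (tau :|: tau')%SET /\ [disjoint tau & tau'].

Definition link_rays : {set sf_I Sg} := [set i | `[< sf_link [set i]%SET >]]%SET.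

Definition link_index : finType := {i : sf_I Sg | i \in link_rays}.

(** The cones of Sigma/tau are the images in N(tau) of the cones of Sigma that
    contain tau; the rays of such an image are those of its rays not in tau. *)
Definition quotient_fan : stacky_fan := {|
  sf_N := quotg (sf_b Sg) tau;
  sf_I := link_index;
  sf_b := fun i => to_quotg (sf_b Sg) tau (sf_b Sg (val i));
  sf_cone := fun K : {set link_index} => sf_cone Sg (tau :|: (val @: K))%SET
|}.

End QuotientFan.

Section Lawrence.
Variables (R : realType) (A : arrangement R).

Local Notation I := (arr_I A).
Local Notation a := (gale_dual (arr_res A)).

(** In the index set I + I, inl i and inr i stand for b_{L,i} and b'_{L,i}. *)
Definition pm_gale (z : I + I) : DG (arr_res A) :=
  match z with inl i => a i | inr i => - a i end.

(** sigma(C, theta), where theta = \sum_(i in C) lam i a_i in DG_R. *)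
Definition sigma_set (C : {set I}) (lam : I -> R) : {set I + I} :=
  ([set inl i | i in C & (0 < lam i)%R] :|: [set inr i | i in C & (lam i < 0)%R])%SET.

Definition lawrence_max_cone (M : {set I + I}) :=
  exists (C : {set I}) (lam : I -> R),
  [/\ is_basis R a C,
      bar R (arr_theta A) = \sum_(i in C) lam i *: bar R (a i) &
      M = ~: sigma_set C lam]%SET.

Definition lawrence_fan (resL : resolution pm_gale) : stacky_fan := {|
  sf_N := DG resL;
  sf_I := (I + I)%type;
  sf_b := gale_dual resL;
  sf_cone := fun K => exists2 M, lawrence_max_cone M & K \subset M
|}.

End Lawrence.
Arguments pm_gale {R} A z.

(** * Stacks over the category of affine C-schemes *)

Section Stacks.
Variable R : realType.

(** The base: commutative C-algebras, with C = R[i]; the zero ring is allowed. *)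
Record calg := CAlg {
  calg_ring :> comPzRingType;
  calg_str : {rmorphism R[i] -> calg_ring}
}.

Definition chom (S T : calg) :=
  {f : {rmorphism S -> T} | forall c, f (calg_str S c) = calg_str T c}.

Definition chom_id (S : calg) : chom S S :=
  exist _ (idfun : {rmorphism S -> S}) (fun=> erefl).

Lemma chom_comp_subproof (S T U : calg) (g : chom T U) (f : chom S T) c :
  (sval g \o sval f) (calg_str S c) = calg_str U c.
Proof. by rewrite /= (svalP f) (svalP g). Qed.

Definition chom_comp (S T U : calg) (g : chom T U) (f : chom S T) : chom S U :=
  exist _ (sval g \o sval f : {rmorphism S -> U}) (chom_comp_subproof g f).

(** Categories over the category of affine C-schemes. [cfg_ob X S] is the
    collection of objects over Spec S, and a morphism from an object over Spec S to
    an object over Spec S' lies over a map Spec S -> Spec S', i.e. S' -> S. *)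
Record cfg := Cfg {
  cfg_ob : calg -> Type;
  cfg_hom : forall S S', cfg_ob S -> cfg_ob S' -> Type;
  cfg_base : forall S S' (x : cfg_ob S) (y : cfg_ob S'), cfg_hom x y -> chom S' S;
  cfg_id : forall S (x : cfg_ob S), cfg_hom x x;
  cfg_comp : forall S S' S'' (x : cfg_ob S) (y : cfg_ob S') (z : cfg_ob S''),
    cfg_hom x y -> cfg_hom y z -> cfg_hom x z;
  cfg_base_id : forall S (x : cfg_ob S), cfg_base (cfg_id x) = chom_id S;
  cfg_base_comp : forall S S' S'' (x : cfg_ob S) (y : cfg_ob S') (z : cfg_ob S'')
      (f : cfg_hom x y) (g : cfg_hom y z),
    cfg_base (cfg_comp f g) = chom_comp (cfg_base f) (cfg_base g);
  cfg_comp1 : forall S S' (x : cfg_ob S) (y : cfg_ob S') (f : cfg_hom x y),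
    cfg_comp (cfg_id x) f = f;
  cfg_1comp : forall S S' (x : cfg_ob S) (y : cfg_ob S') (f : cfg_hom x y),
    cfg_comp f (cfg_id y) = f;
  cfg_compA : forall S S' S'' S''' (x : cfg_ob S) (y : cfg_ob S')
      (z : cfg_ob S'') (w : cfg_ob S''')
      (f : cfg_hom x y) (g : cfg_hom y z) (h : cfg_hom z w),
    cfg_comp f (cfg_comp g h) = cfg_comp (cfg_comp f g) h
}.

(** Isomorphism of stacks: there is a functor over the base which is fully faithful
    and essentially surjective on every fibre. *)
Definition stack_iso (X Y : cfg) :=
  exists (F0 : forall S, cfg_ob X S -> cfg_ob Y S)
         (F1 : forall S S' (x : cfg_ob X S) (y : cfg_ob X S'),
            cfg_hom x y -> cfg_hom (F0 S x) (F0 S' y)),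
  [/\ forall S S' (x : cfg_ob X S) (y : cfg_ob X S') (f : cfg_hom x y),
        cfg_base (F1 _ _ _ _ f) = cfg_base f,
      forall S (x : cfg_ob X S), F1 _ _ _ _ (cfg_id x) = cfg_id (F0 S x),
      forall S S' S'' (x : cfg_ob X S) (y : cfg_ob X S') (z : cfg_ob X S'')
          (f : cfg_hom x y) (g : cfg_hom y z),
        F1 _ _ _ _ (cfg_comp f g) = cfg_comp (F1 _ _ _ _ f) (F1 _ _ _ _ g),
      forall S S' (x : cfg_ob X S) (y : cfg_ob X S'), bijective (F1 S S' x y) &
      forall S (y : cfg_ob Y S), exists (x : cfg_ob X S)
          (f : cfg_hom (F0 S x) y) (g : cfg_hom y (F0 S x)),
        [/\ cfg_base f = chom_id S, cfg_base g = chom_id S,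
            cfg_comp f g = cfg_id _ & cfg_comp g f = cfg_id _]].

(** ** The group G = Hom(D, C^* ) *)

(** The T-points of the group scheme Hom_Z(D, G_m): homomorphisms from D to the
    units of T (the values are units since chi x * chi (- x) = 1). *)
Record character (D : zmodType) (T : comPzRingType) := Character {
  chr_fun :> D -> T;
  chr0 : chr_fun 0 = 1;
  chrD : forall x y, chr_fun (x + y) = chr_fun x * chr_fun y
}.

Section Character.
Variable D : zmodType.

Definition chr_one (T : comPzRingType) : character D T :=
  @Character D T (fun=> 1) erefl (fun _ _ => esym (mulr1 1)).

Lemma chr_mul_subproof0 (T : comPzRingType) (g h : character D T) :
  g 0 * h 0 = 1.
Proof. by rewrite !chr0 mulr1. Qed.

Lemma chr_mul_subproofD (T : comPzRingType) (g h : character D T) x y :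
  g (x + y) * h (x + y) = (g x * h x) * (g y * h y).
Proof. by rewrite !chrD mulrACA. Qed.

Definition chr_mul (T : comPzRingType) (g h : character D T) : character D T :=
  Character (chr_mul_subproof0 g h) (chr_mul_subproofD g h).

Lemma chr_map_subproof0 (T U : comPzRingType) (u : {rmorphism T -> U})
  (g : character D T) : u (g 0) = 1.
Proof. by rewrite chr0 rmorph1. Qed.

Lemma chr_map_subproofD (T U : comPzRingType) (u : {rmorphism T -> U})
  (g : character D T) x y : u (g (x + y)) = u (g x) * u (g y).
Proof. by rewrite chrD rmorphM. Qed.

Definition chr_map (T U : comPzRingType) (u : {rmorphism T -> U})
    (g : character D T) : character D U :=
  Character (chr_map_subproof0 u g) (chr_map_subproofD u g).

End Character.

(** ** Principal G-bundles *)

Section FaithfullyFlat.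
Variables (S A : comPzRingType) (eta : {rmorphism S -> A}).

(** Equational criterion: every S-linear relation in A is a consequence of
    relations in S. *)
Definition flat := forall n (s : 'I_n -> S) (x : 'I_n -> A),
  \sum_i eta (s i) * x i = 0 ->
  exists k (c : 'I_n -> 'I_k -> S) (y : 'I_k -> A),
    (forall i, x i = \sum_j eta (c i j) * y j) /\
    (forall j, \sum_i s i * c i j = 0).

(** In addition, I A <> A for every proper ideal I of S. *)
Definition faithfully_flat := flat /\
  forall n (s : 'I_n -> S) (x : 'I_n -> A),
    \sum_i eta (s i) * x i = 1 -> exists c : 'I_n -> S, \sum_i s i * c i = 1.

End FaithfullyFlat.

(** A G-torsor P -> Spec S, G = Hom(D, G_m). As G is affine, so is P -> Spec S, hence
    P = Spec A; T-points of P are ring morphisms A -> T (each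
    makes T an S-algebra, hence a C-algebra when S is one). The action of G on P over
    Spec S is given on T-points, naturally in T. Being a torsor means that P -> Spec S
    is faithfully flat and that G(T) acts simply transitively on the fibres of
    P(T) -> (Spec S)(T). Since G is smooth over C, these torsors are exactly those
    that are locally trivial for the etale topology. *)
Record torsor (D : zmodType) (S : comPzRingType) := Torsor {
  tor_A : comPzRingType;
  tor_eta : {rmorphism S -> tor_A};
  tor_act : forall T : comPzRingType,
    character D T -> {rmorphism tor_A -> T} -> {rmorphism tor_A -> T};
  tor_act_base : forall (T : comPzRingType) (g : character D T)
    (p : {rmorphism tor_A -> T}), tor_act g p \o tor_eta =1 p \o tor_eta;
  tor_act1 : forall (T : comPzRingType) (p : {rmorphism tor_A -> T}),
    tor_act (chr_one D T) p =1 p;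
  tor_actM : forall (T : comPzRingType) (g h : character D T)
    (p : {rmorphism tor_A -> T}),
    tor_act (chr_mul g h) p =1 tor_act g (tor_act h p);
  tor_act_nat : forall (T U : comPzRingType) (u : {rmorphism T -> U})
    (g : character D T) (p : {rmorphism tor_A -> T}),
    tor_act (chr_map u g) (u \o p : {rmorphism tor_A -> U}) =1 u \o tor_act g p;
  tor_ff : faithfully_flat tor_eta;
  tor_simply_transitive : forall (T : comPzRingType) (p q : {rmorphism tor_A -> T}),
    p \o tor_eta =1 q \o tor_eta -> exists! g : character D T, tor_act g p =1 q
}.

(** ** Toric Deligne-Mumford stacks *)

Section ToricStack.
Variables (Sg : stacky_fan) (res : resolution (sf_b Sg)).

Local Notation I := (sf_I Sg).
Local Notation D := (DG res).
Local Notation a := (gale_dual res).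

(** The A-point x of affine space lies in the complement of V(J_Sigma): the monomials
    \prod_(i \notin K) x i, K a cone, which generate J_Sigma, generate the unit ideal
    of A. *)
Definition in_Z (A : comPzRingType) (x : I -> A) :=
  exists c : {set I} -> A, (forall K, ~ sf_cone Sg K -> c K = 0) /\
    \sum_(K : {set I}) c K * \prod_(i in (~: K)%SET) x i = 1.

(** The objects of [Z / G] over Spec S are the G-torsors P -> Spec S with a
    G-equivariant map P -> Z; a map P = Spec A -> Z is a point of Z(A), and G acts
    on Z through g.z = (g(a_i) z_i)_i. *)
Record toric_ob (S : calg) := ToricOb {
  to_tor :> torsor D S;
  to_x : I -> tor_A to_tor;
  to_Z : in_Z to_x;
  to_equivariant : forall (T : comPzRingType) (g : character D T)
    (p : {rmorphism tor_A to_tor -> T}) (i : I),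
    tor_act g p (to_x i) = g (a i) * p (to_x i)
}.

(** Morphisms are the commutative squares with a G-equivariant map P -> P' over
    Spec S -> Spec S' compatible with the maps to Z. *)
Record toric_hom (S S' : calg) (P : toric_ob S) (P' : toric_ob S') := ToricHom {
  th_base : chom S' S;
  th_map : {rmorphism tor_A P' -> tor_A P};
  th_square : th_map \o tor_eta P' =1 tor_eta P \o sval th_base;
  th_equivariant : forall (T : comPzRingType) (g : character D T)
    (p : {rmorphism tor_A P -> T}),
    tor_act g p \o th_map =1 tor_act g (p \o th_map : {rmorphism tor_A P' -> T});
  th_x : forall i, th_map (to_x P' i) = to_x P i
}.

Lemma rmorph_eq (A B : comPzRingType) (f g : {rmorphism A -> B}) :
  f =1 g -> f = g.
Proof.
case: f g => [f [[f1] [f2]]] [g [[g1] [g2]]] /= /funext fg.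
subst g; congr (GRing.RMorphism.Pack (GRing.RMorphism.Class _ _)).
  by congr (Algebra.isNmodMorphism.Axioms_ _); apply: Prop_irrelevance.
by congr (GRing.isMonoidMorphism.Axioms_ _); apply: Prop_irrelevance.
Qed.

Lemma chom_eq (S T : calg) (f g : chom S T) : sval f =1 sval g -> f = g.
Proof.
case: f g => [f fP] [g gP] /= /rmorph_eq fg; subst g.
by congr exist; apply: Prop_irrelevance.
Qed.

Section Hom.
Variables (S S' S'' : calg).
Variables (P : toric_ob S) (P' : toric_ob S') (P'' : toric_ob S'').

Lemma toric_hom_eq (f g : toric_hom P P') :
  th_base f = th_base g -> th_map f =1 th_map g -> f = g.
Proof.
case: f g => [f0 f1 f2 f3 f4] [g0 g1 g2 g3 g4] /= fg0 /rmorph_eq fg1.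
by subst g0 g1; congr ToricHom; apply: Prop_irrelevance.
Qed.

Lemma toric_id_square :
  (idfun : {rmorphism tor_A P -> tor_A P}) \o tor_eta P
    =1 tor_eta P \o sval (chom_id S).
Proof. by []. Qed.

Lemma toric_id_equivariant (T : comPzRingType) (g : character D T)
    (p : {rmorphism tor_A P -> T}) :
  tor_act g p \o (idfun : {rmorphism tor_A P -> tor_A P})
    =1 tor_act g (p \o (idfun : {rmorphism tor_A P -> tor_A P})
                  : {rmorphism tor_A P -> T}).
Proof.
set q := (X in _ =1 tor_act g X).
by have -> : q = p by apply: rmorph_eq.
Qed.

Definition toric_id : toric_hom P P :=
  ToricHom toric_id_square toric_id_equivariant (fun=> erefl).

Variables (f : toric_hom P P') (g : toric_hom P' P'').

Let map_comp : {rmorphism tor_A P'' -> tor_A P} := th_map f \o th_map g.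

Lemma toric_comp_square :
  map_comp \o tor_eta P''
    =1 tor_eta P \o sval (chom_comp (th_base f) (th_base g)).
Proof.
move=> s /=; have /= -> := th_square g s.
by have /= -> := th_square f (sval (th_base g) s).
Qed.

Lemma toric_comp_equivariant (T : comPzRingType) (h : character D T)
    (p : {rmorphism tor_A P -> T}) :
  tor_act h p \o map_comp
    =1 tor_act h (p \o map_comp : {rmorphism tor_A P'' -> T}).
Proof.
move=> x /=; have /= -> := th_equivariant f h p (th_map g x).
have /= -> := th_equivariant g h (p \o th_map f : {rmorphism _ -> _}) x.
by set q := (X in tor_act h X x); set r := (X in _ = tor_act h X x);
  have -> : q = r by apply: rmorph_eq.
Qed.

Lemma toric_comp_x i : map_comp (to_x P'' i) = to_x P i.
Proof. by rewrite /= th_x th_x. Qed.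

Definition toric_comp : toric_hom P P'' :=
  ToricHom toric_comp_square toric_comp_equivariant toric_comp_x.

End Hom.

Program Definition toric_stack : cfg := {|
  cfg_ob := toric_ob;
  cfg_hom := toric_hom;
  cfg_base := th_base;
  cfg_id := toric_id;
  cfg_comp := toric_comp
|}.
Next Obligation. by []. Qed.
Next Obligation. by []. Qed.
Next Obligation. by move=> *; apply: toric_hom_eq => //; apply: chom_eq. Qed.
Next Obligation. by move=> *; apply: toric_hom_eq => //; apply: chom_eq. Qed.
Next Obligation. by move=> *; apply: toric_hom_eq => //; apply: chom_eq. Qed.

End ToricStack.

(** The existential choices of resolutions only affect the stack up to isomorphism. *)
Definition is_lawrence_stack (X : cfg) :=
  exists (A : arrangement R) (resL : resolution (pm_gale A))
         (res : resolution (sf_b (lawrence_fan resL))),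
    stack_iso X (toric_stack res).

End Stacks.

(* Main.v *)
Require Import Defs.
From HB Require Import structures.
From mathcomp Require Import all_boot all_order all_algebra.
From mathcomp Require Import ring_quotient.
From mathcomp Require Import all_classical all_reals.

Set Implicit Arguments.
Unset Strict Implicit.
Unset Printing Implicit Defensive.

Import Order.TTheory GRing.Theory Num.Theory.
Local Open Scope ring_scope.

(** A toric stack depends only on the Gale dual [D] of its vectors, on the images of
    the basis vectors in [D], and on the cones.  Gale duality is an involution, so the
    Lawrence fan of [(N, b, theta)] has Gale dual [(D, +-a)], where [(D, a)] is the dual
    of [b].  Dividing a stacky fan by a cone [tau] divides its Gale dual by the [a_i]
    with [rho_i] neither in [tau] nor in the link of [tau].

    Let [J] be the set of indices outside [F] and its link [L].  Each [b_j], [j \in J],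
    depends rationally on [F]; hence [j] lies in every basis of [D_R] disjoint from [F],
    and the coordinate of [theta] at [j] is the same for all of them.  So [T] contains
    exactly one of [j], [j'], the rays of the link of [sigma_theta] are those of [L] and
    [L'], and the Gale dual of the quotient fan is [D / <a_j : j \in J>], which is also
    the Gale dual of [b] restricted to [L] with values in [N / <b_i : i \in F>].  With
    the image of [theta] the latter is a stacky hyperplane arrangement, and its Lawrence
    fan has the same cones as the quotient fan. *)

(** * Isomorphic Gale duals define isomorphic quotient stacks *)

(** Everything at [J] rests on one fact: a relation [\sum_i c_i b_i = 0] is the same as a functional
    on [D] with value [c_i] at each [a_i]. For [j \in J] a dependence of [b_j] on [F] gives a
    functional that vanishes at every [a_i] with [i] outside [F] and different from [j], but not at
    [a_j]. Evaluating it determines the coordinate at [j] of any combination of the [a_i],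
    [i \notin F]. Torsion splits the argument into two levels: the group [G] sees the torsion of
    [D], so Gale duals are compared over the integers through explicit presentations, whereas bases,
    genericity and cones only see [D_R] and are treated with real coefficient vectors. *)

Lemma character_eq (D : zmodType) (T : comPzRingType) (g h : character D T) :
  g =1 h -> g = h.
Proof.
case: g h => [g g1 g2] [h h1 h2] /= /funext gh; subst h.
by congr Character; apply: Prop_irrelevance.
Qed.

Section CharacterComp.
Variables (D D' : zmodType) (u : {additive D -> D'}).

Lemma chr_comp0 (T : comPzRingType) (g : character D' T) : g (u 0) = 1.
Proof. by rewrite raddf0 chr0. Qed.

Lemma chr_compD (T : comPzRingType) (g : character D' T) x y :
  g (u (x + y)) = g (u x) * g (u y).
Proof. by rewrite raddfD chrD. Qed.

Definition chr_comp (T : comPzRingType) (g : character D' T) : character D T :=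
  Character (chr_comp0 g) (chr_compD g).

End CharacterComp.

Section TorsorTransport.
Variables (D D' : zmodType) (u : {additive D -> D'}) (v : {additive D' -> D}).
Hypotheses (uK : cancel u v) (vK : cancel v u).
Variables (S : comPzRingType) (P : torsor D S).

Let act (T : comPzRingType) (g : character D' T) (p : {rmorphism tor_A P -> T}) :=
  tor_act (chr_comp u g) p.

Lemma transport_act1 (T : comPzRingType) (p : {rmorphism tor_A P -> T}) :
  act (chr_one D' T) p =1 p.
Proof.
rewrite /act (_ : chr_comp _ _ = chr_one D T); first exact: tor_act1.
exact: character_eq.
Qed.

Lemma transport_actM (T : comPzRingType) (g h : character D' T)
    (p : {rmorphism tor_A P -> T}) :
  act (chr_mul g h) p =1 act g (act h p).
Proof.
rewrite /act.
rewrite (_ : chr_comp _ _ = chr_mul (chr_comp u g) (chr_comp u h)).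
  exact: tor_actM.
exact: character_eq.
Qed.

Lemma transport_act_nat (T U : comPzRingType) (w : {rmorphism T -> U})
    (g : character D' T) (p : {rmorphism tor_A P -> T}) :
  act (chr_map w g) (w \o p : {rmorphism tor_A P -> U}) =1 w \o act g p.
Proof.
rewrite /act (_ : chr_comp _ _ = chr_map w (chr_comp u g)).
  exact: tor_act_nat.
exact: character_eq.
Qed.

Lemma transport_simply_transitive (T : comPzRingType)
    (p q : {rmorphism tor_A P -> T}) :
  p \o @tor_eta D S P =1 q \o @tor_eta D S P ->
  exists! g : character D' T, act g p =1 q.
Proof.
move=> /tor_simply_transitive[g [gpq g_uniq]].
exists (chr_comp v g); split=> [|h hpq].
  rewrite /act (_ : chr_comp _ _ = g) //.
  by apply: character_eq => x /=; rewrite uK.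
have := g_uniq _ hpq => ->.
by apply: character_eq => x /=; rewrite vK.
Qed.

(** The algebra and the structure map are kept and only the acting group is renamed, so the maps of
    a [toric_hom] serve unchanged after transport. *)
Definition torsor_transport : torsor D' S :=
  @Torsor D' S (tor_A P) (@tor_eta D S P) act
    (fun T g p => tor_act_base (chr_comp u g) p)
    transport_act1 transport_actM transport_act_nat
    (tor_ff P) transport_simply_transitive.

End TorsorTransport.

Section StackTransport.
Variables (R : realType) (Sg Sg' : stacky_fan).
Variables (res : resolution (sf_b Sg)) (res' : resolution (sf_b Sg')).
Variables (u : {additive DG res -> DG res'}) (v : {additive DG res' -> DG res}).
Variables (h : sf_I Sg -> sf_I Sg') (k : sf_I Sg' -> sf_I Sg).
Hypotheses (uK : cancel u v) (vK : cancel v u) (hK : cancel h k) (kK : cancel k h).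
Hypothesis u_gale : forall i, u (gale_dual res i) = gale_dual res' (h i).
Hypothesis cone_h : forall K, sf_cone Sg K -> sf_cone Sg' (h @: K)%SET.

Lemma in_Z_transport (A : comPzRingType) (x : sf_I Sg -> A) :
  in_Z x -> @in_Z Sg' A (x \o k).
Proof.
have kI := can_inj kK; have hI := can_inj hK.
have hkS (K : {set sf_I Sg'}) : (h @: (k @: K) = K)%SET.
  by rewrite -imset_comp -[RHS]imset_id; apply: eq_imset => i /=; rewrite kK.
have khS (K : {set sf_I Sg}) : (k @: (h @: K) = K)%SET.
  by rewrite -imset_comp -[RHS]imset_id; apply: eq_imset => i /=; rewrite hK.
case=> c [c0 c1]; exists (fun K : {set _} => c (k @: K)%SET); split=> [K nK|].
  by apply: c0 => /cone_h; rewrite hkS.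
rewrite -[RHS]c1 (reindex (fun K : {set sf_I Sg} => h @: K)%SET) /=; last first.
  by exists (fun K : {set sf_I Sg'} => k @: K)%SET => K _.
apply: eq_bigr => K _; rewrite khS; congr (_ * _).
rewrite (reindex h) /=; last by exists k => i _.
apply: eq_big => [i|i _]; last by rewrite hK.
by rewrite !inE mem_imset.
Qed.

Lemma equivariant_transport (S : calg R) (P : toric_ob res S) (T : comPzRingType)
    (g : character (DG res') T)
    (p : {rmorphism tor_A (torsor_transport uK vK P) -> T}) (i : sf_I Sg') :
  tor_act g p (to_x P (k i)) = g (gale_dual res' i) * p (to_x P (k i)).
Proof. by rewrite [LHS](to_equivariant (chr_comp u g) p) /= u_gale kK. Qed.

Definition toric_ob_transport (S : calg R) (P : toric_ob res S) : toric_ob res' S :=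
  @ToricOb R Sg' res' S (torsor_transport uK vK P) (to_x P \o k)
    (in_Z_transport (to_Z P)) (equivariant_transport (P := P)).

Section HomTransport.
Variables (S S' : calg R) (P : toric_ob res S) (P' : toric_ob res S').

Definition toric_hom_transport (f : toric_hom P P') :
    toric_hom (toric_ob_transport P) (toric_ob_transport P') :=
  @ToricHom R Sg' res' S S' (toric_ob_transport P) (toric_ob_transport P')
    (th_base f) (th_map f) (th_square f)
    (fun T g => th_equivariant f (chr_comp u g)) (fun i => th_x f (k i)).

Lemma toric_hom_transport_bij : bijective toric_hom_transport.
Proof.
have fE (f : toric_hom (toric_ob_transport P) (toric_ob_transport P'))
    (T : comPzRingType) (g : character (DG res) T) (p : {rmorphism tor_A P -> T}) :
    tor_act g p \o (th_map f : {rmorphism tor_A P' -> tor_A P}) =1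
    tor_act g (p \o (th_map f : {rmorphism tor_A P' -> tor_A P})
               : {rmorphism tor_A P' -> T}).
  have := th_equivariant f (chr_comp v g) p; rewrite /=.
  have -> : chr_comp u (chr_comp v g) = g.
    by apply: character_eq => x /=; rewrite uK.
  by [].
have fx (f : toric_hom (toric_ob_transport P) (toric_ob_transport P')) i :
    (th_map f : {rmorphism tor_A P' -> tor_A P}) (to_x P' i) = to_x P i.
  by have := th_x f (h i); rewrite /= hK.
exists (fun f : toric_hom (toric_ob_transport P) (toric_ob_transport P') =>
  @ToricHom R Sg res S S' P P' (th_base f) (th_map f) (th_square f) (fE f) (fx f))
  => f; exact: toric_hom_eq.
Qed.

End HomTransport.
End StackTransport.

Lemma stack_iso_gale (R : realType) (Sg Sg' : stacky_fan)
    (res : resolution (sf_b Sg)) (res' : resolution (sf_b Sg'))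
    (u : {additive DG res -> DG res'}) (v : {additive DG res' -> DG res})
    (h : sf_I Sg -> sf_I Sg') (k : sf_I Sg' -> sf_I Sg) :
  cancel u v -> cancel v u -> cancel h k -> cancel k h ->
  (forall i, u (gale_dual res i) = gale_dual res' (h i)) ->
  (forall K, sf_cone Sg K <-> sf_cone Sg' (h @: K)%SET) ->
  stack_iso (toric_stack R res) (toric_stack R res').
Proof.
move=> uK vK hK kK u_gale cone_h.
have v_gale i : v (gale_dual res' i) = gale_dual res (k i).
  by rewrite -[i in LHS]kK -u_gale uK.
have cone_k K : sf_cone Sg' K -> sf_cone Sg (k @: K)%SET.
  rewrite cone_h -imset_comp; congr (sf_cone _ _).
  by rewrite -[LHS]imset_id; apply: eq_imset => i /=; rewrite kK.
have cone_h1 K := (cone_h K).1.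
exists (@toric_ob_transport R _ _ _ _ u v h k uK vK hK kK u_gale cone_h1).
exists (@toric_hom_transport R _ _ _ _ u v h k uK vK hK kK u_gale cone_h1).
split=> //.
- by move=> S P; apply: toric_hom_eq.
- by move=> *; apply: toric_hom_eq.
- exact: toric_hom_transport_bij.
move=> S Y.
(* The round trip keeps the algebra of [Y], but its action and coordinates return only up to
   [chr_comp v (chr_comp u g) = g] and [h (k i) = i]. The identity of the algebra therefore gives an
   isomorphism from [Y'] to [Y]. *)
pose X := @toric_ob_transport R _ _ _ _ v u k h vK uK kK hK v_gale cone_k S Y.
pose Y' := @toric_ob_transport R _ _ _ _ u v h k uK vK hK kK u_gale cone_h1 S X.
have actE (T : comPzRingType) (g : character (DG res') T)
    (p : {rmorphism tor_A Y -> T}) : @tor_act _ _ Y' T g p = @tor_act _ _ Y T g p.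
  rewrite [LHS]/= (_ : chr_comp v (chr_comp u g) = g) //.
  by apply: character_eq => x /=; rewrite vK.
have xE i : to_x Y' i = to_x Y i by rewrite /= kK.
have idE (T : comPzRingType) (p : {rmorphism tor_A Y -> T}) :
    (p \o (idfun : {rmorphism tor_A Y -> tor_A Y}) : {rmorphism tor_A Y -> T}) = p.
  exact: rmorph_eq.
pose f : toric_hom Y' Y := @ToricHom R _ _ S S Y' Y (chom_id S)
  (idfun : {rmorphism tor_A Y -> tor_A Y}) (fun=> erefl)
  (fun T g p x => etrans (congr1 (fun q : {rmorphism _ -> _} => q x) (actE T g p))
     (congr1 (fun q => tor_act g q x) (esym (idE T p)))) (fun i => esym (xE i)).
pose g : toric_hom Y Y' := @ToricHom R _ _ S S Y Y' (chom_id S)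
  (idfun : {rmorphism tor_A Y -> tor_A Y}) (fun=> erefl)
  (fun T g p x => etrans (congr1 (fun q : {rmorphism _ -> _} => q x)
     (esym (actE T g p)))
     (congr1 (fun q => @tor_act _ _ Y' T g q x) (esym (idE T p)))) xE.
by exists X, f, g; split=> //; apply: toric_hom_eq => //; apply: chom_eq.
Qed.

(** * Presentations and Gale pairs *)

Section Quotg.
Variables (N : zmodType) (I : finType) (b : I -> N) (F : {set I}).

Lemma to_quotg_zmod_morphism : zmod_morphism (to_quotg b F).
Proof. by move=> x y; rewrite /to_quotg raddfB. Qed.

HB.instance Definition _ :=
  GRing.isZmodMorphism.Build N (quotg b F) (to_quotg b F) to_quotg_zmod_morphism.

Lemma to_quotg_surj x : exists y, to_quotg b F y = x.
Proof. by exists (repr x); rewrite /to_quotg reprK. Qed.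

Lemma to_quotg_eq0 x :
  to_quotg b F x = 0 <-> exists c : I -> int, x = \sum_(i in F) b i *~ c i.
Proof.
have -> : (to_quotg b F x = 0) <-> (gen_mem b F x).
  rewrite -(raddf0 (to_quotg b F)) /to_quotg; split.
    by move/eqP; rewrite -Quotient.idealrBE subr0.
  by move=> bx; apply/eqP; rewrite -Quotient.idealrBE subr0.
by split=> [/asboolP|/asboolP].
Qed.

End Quotg.

Lemma sum_mulrz_comp (N : zmodType) (I J : finType) (x : J -> N)
    (M : I -> J -> int) (c : I -> int) :
  \sum_j x j *~ (\sum_i c i * M i j) = \sum_i (\sum_j x j *~ M i j) *~ c i.
Proof.
under eq_bigr => j _ do rewrite mulrz_sumr.
rewrite exchange_big; apply: eq_bigr => i _ /=.
by rewrite mulrz_suml; apply: eq_bigr => j _; rewrite mulrC mulrzA.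
Qed.

Lemma sum_mulr_comp (I J K : finType) (A : I -> J -> int) (M : J -> K -> int) i
    (x : K -> int) :
  \sum_k (\sum_j A i j * M j k) * x k = \sum_j A i j * \sum_k M j k * x k.
Proof.
under eq_bigr do rewrite mulr_suml; rewrite exchange_big; apply: eq_bigr => j _ /=.
by rewrite mulr_sumr; apply: eq_bigr => k _; rewrite mulrA.
Qed.

Lemma sum_mulrz_delta (N : zmodType) (I : finType) (x : I -> N) i :
  \sum_j x j *~ (j == i)%:R = x i.
Proof.
rewrite (bigD1 i) //= eqxx mulr1z big1 ?addr0 // => j /negPf->.
by rewrite mulr0z.
Qed.

Lemma raddf_sum_mulrz (N X : zmodType) (I : finType) (A : pred I)
    (f : {additive N -> X}) (x : I -> N) (c : I -> int) :
  f (\sum_(i | A i) x i *~ c i) = \sum_(i | A i) f (x i) *~ c i.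
Proof. by rewrite raddf_sum; apply: eq_bigr => i _; rewrite raddfMz. Qed.

Lemma additive_of_gens (S : finType) (N X : zmodType) (x : S -> N) (y : S -> X) :
  (forall d, exists c : S -> int, d = \sum_s x s *~ c s) ->
  (forall c : S -> int, \sum_s x s *~ c s = 0 -> \sum_s y s *~ c s = 0) ->
  exists f : {additive N -> X}, forall s, f (x s) = y s.
Proof.
move=> /choice[c cE] rel.
(* Two choices of coefficients for the same element give the same value; this makes the map built on
   the chosen [c] additive. *)
have relB u w : \sum_s x s *~ u s = \sum_s x s *~ w s ->
    \sum_s y s *~ u s = \sum_s y s *~ w s.
  move=> uw; apply/eqP; rewrite -subr_eq0 -sumrB.
  under eq_bigr do rewrite -mulrzBr.
  apply/eqP; apply: (rel (fun s => u s - w s)).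
  by under eq_bigr do rewrite mulrzBr; rewrite sumrB uw subrr.
pose f d := \sum_s y s *~ c d s.
have fB : zmod_morphism f.
  move=> d d'; rewrite /f -sumrB; under [RHS]eq_bigr do rewrite -mulrzBr.
  apply: (relB _ (fun s => c d s - c d' s)); rewrite -cE.
  by under eq_bigr do rewrite mulrzBr; rewrite sumrB -!cE.
pose fM := GRing.isZmodMorphism.Build N X f fB.
pose g : {additive N -> X} := HB.pack f fM.
exists g => s; rewrite -[RHS]sum_mulrz_delta; apply: (relB _ (fun t => (t == s)%:R)).
by rewrite -cE sum_mulrz_delta.
Qed.

Section GalePair.
Variables (I P K : finType).
Implicit Types (Q : K -> P -> int) (B : I -> P -> int).

Definition rows B Q (z : I + K) : P -> int :=
  match z with inl i => B i | inr k => Q k end.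

(** [Z^K -Q-> Z^P -e-> N] is a free resolution and [B] a lift of [b]. *)
Record presents (N : zmodType) (b : I -> N) (e : P -> N) Q B : Prop := Presents {
  pr_gen : forall x, exists u : P -> int, x = \sum_j e j *~ u j;
  pr_inj : forall c : K -> int, (forall j, \sum_k c k * Q k j = 0) ->
    forall k, c k = 0;
  pr_rel : forall u : P -> int, \sum_j e j *~ u j = 0 <->
    exists c : K -> int, forall j, u j = \sum_k c k * Q k j;
  pr_lift : forall i, \sum_j e j *~ B i j = b i
}.

(** [D] is the cokernel of [B Q]^*, with [x] the images of the basis vectors. *)
Definition gale_for B Q (D : zmodType) (a : I -> D) := exists x : I + K -> D,
  [/\ forall i, x (inl i) = a i,
      forall j, \sum_z x z *~ rows B Q z j = 0,
      forall d, exists c : I + K -> int, d = \sum_z x z *~ c z &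
      forall c : I + K -> int, \sum_z x z *~ c z = 0 ->
        exists phi : P -> int, forall z, c z = \sum_j phi j * rows B Q z j].

End GalePair.

(** A relation instead of the construction [DG]: with arbitrary finite types for generators and
    relations, the two can exchange roles or be regrouped by sum types without renumbering. *)
Definition gale_pair (I : finType) (N D : zmodType) (b : I -> N) (a : I -> D) :=
  exists (P K : finType) (e : P -> N) (Q : K -> P -> int) (B : I -> P -> int),
    presents b e Q B /\ gale_for B Q a.

(** For finitely generated [N] this amounts to a finite cokernel, in the form that linear algebra up
    to denominators uses. *)
Definition torsion_coker (I : finType) (N : zmodType) (b : I -> N) :=
  forall x, exists2 k : nat, (0 < k)%N & exists c : I -> int,
    x *+ k = \sum_i b i *~ c i.

Section Resolutions.
Variables (N : zmodType) (I : finType) (b : I -> N).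

Lemma resolution_presents (res : resolution b) :
  presents b (fun j => res_eps res [ffun j' => (j' == j)%:R])
    (fun k j => res_Q res k j) (fun i j => res_B res i j).
Proof.
have uE (u : {ffun 'I_(res_p res) -> int}) :
    u = \sum_j [ffun j' => (j' == j)%:R : int] *~ u j.
  apply/ffunP => j; rewrite sum_ffunE (bigD1 j) //= big1 ?addr0.
    by rewrite ffunMzE ffunE eqxx intz.
  by move=> j' /negPf jj'; rewrite ffunMzE ffunE eq_sym jj' mul0rz.
have epsE (u : {ffun 'I_(res_p res) -> int}) : \sum_j
    res_eps res [ffun j' => (j' == j)%:R] *~ u j = res_eps res u.
  by rewrite {2}[u]uE raddf_sum_mulrz.
have QE (c : 'I_(res_r res) -> int) j :
    (\sum_k res_Q res k *~ c k) j = \sum_k c k * res_Q res k j.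
  by rewrite sum_ffunE; apply: eq_bigr => k _; rewrite ffunMzE mulrzz mulrC.
split=> [x|c Qc|u|i].
- by have [u <-] := res_eps_surj res x; exists u; rewrite epsE.
- by apply: (res_Q_inj (r := res)); apply/ffunP => j; rewrite QE Qc ffunE.
- have := res_exact (r := res) (finfun u); rewrite -epsE.
  under eq_bigr do rewrite ffunE.
  move=> ->; split=> -[c cE]; exists c.
    by move=> j; rewrite -QE -cE ffunE.
  by apply/ffunP => j; rewrite QE ffunE.
by rewrite epsE res_lift.
Qed.

Lemma presents_resolution (P K : finType) (e : P -> N) (Q : K -> P -> int)
    (B : I -> P -> int) : presents b e Q B -> inhabited (resolution b).
Proof.
case=> egen Qinj exact lift.
pose ePU (u : {ffun 'I_#|P| -> int}) := \sum_j e j *~ u (enum_rank j).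
have ePB : zmod_morphism ePU.
  move=> u w; rewrite /ePU -sumrB; apply: eq_bigr => j _.
  by rewrite -mulrzBr !ffunE.
pose ePM := GRing.isZmodMorphism.Build _ _ ePU ePB.
pose eP : {additive {ffun 'I_#|P| -> int} -> N} := HB.pack ePU ePM.
pose QP (k : 'I_#|K|) : {ffun 'I_#|P| -> int} :=
  [ffun j => Q (enum_val k) (enum_val j)].
pose BP i : {ffun 'I_#|P| -> int} := [ffun j => B i (enum_val j)].
have QE (c : 'I_#|K| -> int) j : (\sum_k QP k *~ c k) j =
    \sum_k c (enum_rank k) * Q k (enum_val j).
  rewrite sum_ffunE (reindex enum_rank) /=; last exact/onW_bij/enum_rank_bij.
  by apply: eq_bigr => k _; rewrite ffunMzE ffunE enum_rankK mulrzz mulrC.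
constructor; apply: (@Resolution N I b #|P| #|K| eP QP BP).
- move=> x; have [u ->] := egen x; exists [ffun j => u (enum_val j)].
  by apply: eq_bigr => j _; rewrite ffunE enum_rankK.
- move=> c /ffunP c0 k; rewrite -[k]enum_valK.
  apply: (Qinj (fun k => c (enum_rank k))) => j.
  by have := c0 (enum_rank j); rewrite QE enum_rankK ffunE.
- move=> u; rewrite (exact (fun j => u (enum_rank j))); split=> -[c cE].
    exists (fun k => c (enum_val k)); apply/ffunP => j; rewrite QE.
    by have := cE (enum_val j); rewrite enum_valK => ->;
      apply: eq_bigr => k _; rewrite enum_rankK.
  exists (fun k => c (enum_rank k)) => j.
  by move/ffunP/(_ (enum_rank j)): cE; rewrite QE enum_rankK.
by move=> i; rewrite -lift; apply: eq_bigr => j _; rewrite ffunE enum_rankK.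
Qed.

Lemma DG_gale_for (res : resolution b) :
  gale_for (fun i j => res_B res i j) (fun k j => res_Q res k j) (gale_dual res).
Proof.
pose q : {additive _ -> _} := to_quotg (dual_BQ (res := res)) [set: 'I_(res_p res)]%SET.
pose del z : {ffun I + 'I_(res_r res) -> int} := [ffun z' => (z' == z)%:R].
have uE (u : {ffun I + 'I_(res_r res) -> int}) : u = \sum_z del z *~ u z.
  apply/ffunP => j; rewrite sum_ffunE (bigD1 j) //= big1 ?addr0.
    by rewrite ffunMzE ffunE eqxx intz.
  by move=> j' /negPf jj'; rewrite ffunMzE ffunE eq_sym jj' mul0rz.
have qE (u : {ffun I + 'I_(res_r res) -> int}) :
    \sum_z q (del z) *~ u z = q u by rewrite {2}[u]uE raddf_sum_mulrz.
have rowE j z : rows (fun i j => res_B res i j) (fun k j => res_Q res k j) z j =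
    dual_BQ (res := res) j z by rewrite ffunE; case: z.
exists (q \o del); split=> [//|j|d|c] /=.
- under eq_bigr do rewrite rowE.
  rewrite qE; apply/to_quotg_eq0; exists (fun j' => (j' == j)%:R).
  by under eq_bigl do rewrite inE; rewrite sum_mulrz_delta.
- by have [u <-] := to_quotg_surj d; exists u; rewrite qE.
move=> c0; have /to_quotg_eq0[phi phiE] : q (finfun c) = 0.
  by rewrite -qE; under eq_bigr do rewrite ffunE.
exists phi => z; move/ffunP/(_ z): phiE; rewrite ffunE sum_ffunE => ->.
by apply: eq_big => [j|j _]; rewrite ?inE // rowE ffunMzE mulrzz mulrC.
Qed.

Lemma DG_gale_pair (res : resolution b) : gale_pair b (gale_dual res).
Proof.
by do 5!eexists; split; [exact: resolution_presents | exact: DG_gale_for].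
Qed.

End Resolutions.

(** * Uniqueness of the Gale dual *)

Section Comparison.
Variables (N : zmodType) (I P1 K1 P2 K2 : finType).
Variables (e1 : P1 -> N) (Q1 : K1 -> P1 -> int) (B1 : I -> P1 -> int).
Variables (e2 : P2 -> N) (Q2 : K2 -> P2 -> int) (B2 : I -> P2 -> int).

(** [H] lifts the identity of [N] to the free modules; [S] is the map induced on
    [Z^I (+) Z^K], with the homotopy between the two lifts of [b]. *)
Definition comparison (H : P2 -> P1 -> int) (S : I + K2 -> I + K1 -> int) :=
  [/\ forall j, e2 j = \sum_l e1 l *~ H j l,
      forall z i, S z (inl i) = (z == inl i)%:R &
      forall z l, \sum_j rows B2 Q2 z j * H j l = \sum_y S z y * rows B1 Q1 y l].

End Comparison.

(** The right-hand side is [b i] at [inl i] and zero at [inr k]. In this form it is a relation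
    between the [b i] and the [- e j], which [gale_pair_sym] takes as a relation of the double
    dual. *)
Lemma presents_rows (N : zmodType) (I P K : finType) (b : I -> N) (e : P -> N)
    (Q : K -> P -> int) (B : I -> P -> int) (z : I + K) :
  presents b e Q B ->
  \sum_j e j *~ rows B Q z j = \sum_i b i *~ (z == inl i)%:R.
Proof.
case=> _ _ exact lift; case: z => [i|k] /=.
  rewrite lift (bigD1 i) //= eqxx big1 ?addr0 // => j ji.
  by rewrite (_ : _ == _ = false) //; apply: contraNF ji => /eqP[->].
rewrite [RHS]big1 //; apply/exact; exists (fun k' => (k' == k)%:R) => j.
rewrite (bigD1 k) //= eqxx mul1r big1 ?addr0 // => k' /negPf->.
by rewrite mul0r.
Qed.

Lemma exists_comparison (N : zmodType) (I P1 K1 P2 K2 : finType) (b : I -> N)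
    (e1 : P1 -> N) (Q1 : K1 -> P1 -> int) (B1 : I -> P1 -> int)
    (e2 : P2 -> N) (Q2 : K2 -> P2 -> int) (B2 : I -> P2 -> int) :
  presents b e1 Q1 B1 -> presents b e2 Q2 B2 ->
  exists H S, comparison e1 Q1 B1 e2 Q2 B2 H S.
Proof.
move=> pr1 pr2.
have /choice[H HE] j := pr_gen pr1 (e2 j); exists H.
(* [H] sends a row of [Q2] to a relation of the first presentation, and the lift [B2 i] to [B1 i]
   plus such a relation. Its coefficients [c z] are the remaining entries of [S]. *)
have /choice[c cE] z : exists c : K1 -> int, forall l,
    \sum_j rows B2 Q2 z j * H j l - \sum_i (z == inl i)%:R * B1 i l =
    \sum_k c k * Q1 k l.
  apply/(pr_rel pr1); under eq_bigr do rewrite mulrzBr; rewrite sumrB.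
  rewrite !sum_mulrz_comp; under eq_bigr do rewrite -HE.
  rewrite (presents_rows z pr2).
  by under [X in _ - X]eq_bigr do rewrite (pr_lift pr1); rewrite subrr.
exists (fun z y => match y with inl i => (z == inl i)%:R | inr k => c z k end).
by split=> // z l; rewrite big_sumType /= -cE addrC subrK.
Qed.

(** Dualizing reverses arrows: a lift from the second presentation to the first induces a map from
    [D1] to [D2]. A relation among the [x1] comes from some [phi] on [Z^P1], and its image comes
    from [phi] composed with [H]. *)
Lemma comparison_hom (N D1 D2 : zmodType) (I P1 K1 P2 K2 : finType)
    (e1 : P1 -> N) (Q1 : K1 -> P1 -> int) (B1 : I -> P1 -> int)
    (e2 : P2 -> N) (Q2 : K2 -> P2 -> int) (B2 : I -> P2 -> int)
    (H : P2 -> P1 -> int) (S : I + K2 -> I + K1 -> int)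
    (x1 : I + K1 -> D1) (x2 : I + K2 -> D2) :
  comparison e1 Q1 B1 e2 Q2 B2 H S ->
  (forall d, exists c : I + K1 -> int, d = \sum_z x1 z *~ c z) ->
  (forall c : I + K1 -> int, \sum_z x1 z *~ c z = 0 ->
     exists phi : P1 -> int, forall z, c z = \sum_j phi j * rows B1 Q1 z j) ->
  (forall j, \sum_z x2 z *~ rows B2 Q2 z j = 0) ->
  exists f : {additive D1 -> D2}, forall y, f (x1 y) = \sum_z x2 z *~ S z y.
Proof.
move=> [_ _ HS] gen1 rel1 rel2; apply: additive_of_gens => // c /rel1[phi cE].
rewrite -(sum_mulrz_comp x2 (fun y z => S z y)).
transitivity (\sum_z x2 z *~ (\sum_j (\sum_l H j l * phi l) * rows B2 Q2 z j)).
  apply: eq_bigr => z _; congr (_ *~ _).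
  under [RHS]eq_bigr do rewrite mulrC; rewrite -sum_mulr_comp.
  under [RHS]eq_bigr do rewrite HS; rewrite sum_mulr_comp.
  apply: eq_bigr => y _; rewrite mulrC cE; congr (_ * _).
  by apply: eq_bigr => l _; rewrite mulrC.
by rewrite sum_mulrz_comp big1 // => j _; rewrite rel2 mul0rz.
Qed.

(** The composite [T] of the two comparisons is homotopic to the identity: it differs from it by
    [rows B1 Q1] followed by the homotopy [u], and [x1] kills the columns of [rows B1 Q1]. *)
Lemma comparison_comp (N D1 : zmodType) (I P1 K1 P2 K2 : finType) (b : I -> N)
    (e1 : P1 -> N) (Q1 : K1 -> P1 -> int) (B1 : I -> P1 -> int)
    (e2 : P2 -> N) (Q2 : K2 -> P2 -> int) (B2 : I -> P2 -> int)
    (H : P2 -> P1 -> int) (S : I + K2 -> I + K1 -> int)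
    (H' : P1 -> P2 -> int) (S' : I + K1 -> I + K2 -> int) (x1 : I + K1 -> D1) :
  presents b e1 Q1 B1 ->
  comparison e1 Q1 B1 e2 Q2 B2 H S -> comparison e2 Q2 B2 e1 Q1 B1 H' S' ->
  (forall j, \sum_z x1 z *~ rows B1 Q1 z j = 0) ->
  forall y, \sum_z (\sum_w x1 w *~ S' w z) *~ S z y = x1 y.
Proof.
move=> pr1 [HE Sl HS] [HE' Sl' HS'] rel1 y.
rewrite -(sum_mulrz_comp x1 (fun z w => S' w z)).
pose T w y := \sum_z S' w z * S z y.
transitivity (\sum_w x1 w *~ T w y).
  by apply: eq_bigr => w _; congr (_ *~ _); apply: eq_bigr => z _; rewrite mulrC.
have Tl w i : T w (inl i) = (w == inl i)%:R.
  rewrite /T; under eq_bigr do rewrite Sl; rewrite -Sl' (bigD1 (inl i)) //=.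
  by rewrite eqxx mulr1 big1 ?addr0 // => z /negPf->; rewrite mulr0.
case: y => [i|k]; first by under eq_bigr do rewrite Tl; rewrite sum_mulrz_delta.
have /choice[u uE] l : exists u : K1 -> int, forall l',
    \sum_j H' l j * H j l' - (l' == l)%:R = \sum_k u k * Q1 k l'.
  apply/(pr_rel pr1); under eq_bigr do rewrite mulrzBr; rewrite sumrB.
  rewrite sum_mulrz_comp; under eq_bigr do rewrite -HE.
  by rewrite -HE' sum_mulrz_delta subrr.
(* Both sides give the same combination of the rows of [Q1], so injectivity of [Q1] identifies the
   coefficients. *)
have TE w k' : T w (inr k') =
    (w == inr k')%:R + \sum_l rows B1 Q1 w l * u l k'.
  apply/eqP; rewrite -subr_eq0; apply/eqP.
  apply: (pr_inj pr1
    (c := fun k' => T w (inr k') - ((w == inr k')%:R + \sum_l rows B1 Q1 w l * u l k'))).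
  move=> l'; under eq_bigr do rewrite mulrBl mulrDl; rewrite sumrB big_split /=.
  apply/eqP; rewrite subr_eq0; apply/eqP.
  rewrite [X in _ = _ + X]sum_mulr_comp.
  under [X in _ = _ + X]eq_bigr do rewrite -uE mulrBr.
  rewrite sumrB; have -> : \sum_l rows B1 Q1 w l * (\sum_j H' l j * H j l') =
      \sum_y T w y * rows B1 Q1 y l'.
    rewrite -sum_mulr_comp; under eq_bigr do rewrite HS'.
    rewrite sum_mulr_comp; under eq_bigr do rewrite HS.
    by rewrite -sum_mulr_comp.
  rewrite big_sumType /=.
  under [X in _ = _ + (X + _ - _)]eq_bigr do rewrite Tl.
  have -> : \sum_l rows B1 Q1 w l * (l' == l)%:R = rows B1 Q1 w l'.
    rewrite (bigD1 l') //= eqxx mulr1 big1 ?addr0 // => l /negPf.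
    by rewrite eq_sym => ->; rewrite mulr0.
  have -> : rows B1 Q1 w l' =
      \sum_k0 (w == inr k0)%:R * Q1 k0 l' + \sum_i (w == inl i)%:R * B1 i l'.
    case: w => [i|k0] /=.
      rewrite [X in _ = X + _]big1 => [|k0 _]; last by rewrite mul0r.
      rewrite (bigD1 i) //= eqxx mul1r big1 ?addr0 ?add0r // => j ji.
      rewrite (_ : _ == _ = false) ?mul0r //.
      by apply: contraNF ji => /eqP[->].
    rewrite [X in _ = _ + X]big1 => [|i _]; last by rewrite mul0r.
    rewrite (bigD1 k0) //= eqxx mul1r big1 ?addr0 // => j ji.
    rewrite (_ : _ == _ = false) ?mul0r //.
    by apply: contraNF ji => /eqP[->].
  by rewrite !addrA [RHS]addrC addKr.
under eq_bigr do rewrite TE mulrzDr; rewrite big_split /= sum_mulrz_delta.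
under [X in _ + X]eq_bigr => z _ do under eq_bigr => l _ do rewrite mulrC.
rewrite (sum_mulrz_comp x1 (fun l z => rows B1 Q1 z l)) big1 ?addr0 // => l _.
by rewrite rel1 mul0rz.
Qed.

Lemma gale_pair_iso (I : finType) (N D1 D2 : zmodType) (b : I -> N)
    (a1 : I -> D1) (a2 : I -> D2) :
  gale_pair b a1 -> gale_pair b a2 ->
  exists (f : {additive D1 -> D2}) (g : {additive D2 -> D1}),
    [/\ cancel f g, cancel g f, forall i, f (a1 i) = a2 i &
        forall i, g (a2 i) = a1 i].
Proof.
move=> [P1 [K1 [e1 [Q1 [B1 [pr1 [x1 [xa1 rel1 gen1 exact1]]]]]]]].
move=> [P2 [K2 [e2 [Q2 [B2 [pr2 [x2 [xa2 rel2 gen2 exact2]]]]]]]].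
have [H [S HS]] := exists_comparison pr1 pr2.
have [H' [S' HS']] := exists_comparison pr2 pr1.
have [f fE] := comparison_hom HS gen1 exact1 rel2.
have [g gE] := comparison_hom HS' gen2 exact2 rel1.
have fa i : f (a1 i) = a2 i.
  rewrite -xa1 fE; have [_ Sl _] := HS; under eq_bigr do rewrite Sl.
  by rewrite sum_mulrz_delta.
have ga i : g (a2 i) = a1 i.
  rewrite -xa2 gE; have [_ Sl _] := HS'; under eq_bigr do rewrite Sl.
  by rewrite sum_mulrz_delta.
exists f, g; split=> // d.
  have [c ->] := gen1 d; rewrite !raddf_sum_mulrz; apply: eq_bigr => z _.
  rewrite fE raddf_sum_mulrz; under eq_bigr do rewrite gE.
  by rewrite (comparison_comp pr1 HS HS' rel1).
have [c ->] := gen2 d; rewrite !raddf_sum_mulrz; apply: eq_bigr => z _.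
rewrite gE raddf_sum_mulrz; under eq_bigr do rewrite fE.
by rewrite (comparison_comp pr2 HS' HS rel2).
Qed.

(** * Gale duality as an involution *)

Lemma presents_hom (N : zmodType) (I P K : finType) (b : I -> N) (e : P -> N)
    (Q : K -> P -> int) (B : I -> P -> int) (c : P -> int) :
  presents b e Q B -> (forall k, \sum_j c j * Q k j = 0) ->
  exists g : {additive N -> int}, forall j, g (e j) = c j.
Proof.
case=> egen _ exact _ cQ; apply: additive_of_gens => // u /exact[w uE].
under eq_bigr do rewrite uE; rewrite sum_mulrz_comp big1 // => k _.
by under eq_bigr do rewrite mulrzz; rewrite cQ mul0rz.
Qed.

(** Transposing the matrix presents [D] with generators [I + K] and relations [P]. These relations
    are independent because a functional on [Z^P] vanishing on all rows descends to [N] and kills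
    every [b i], hence a positive multiple of each element, so it is zero. *)
Lemma gale_pair_sym (I : finType) (N D : zmodType) (b : I -> N) (a : I -> D) :
  torsion_coker b -> gale_pair b a -> gale_pair a b.
Proof.
move=> tb [P [K [e [Q [B [pr [x [xa rel gen exact]]]]]]]].
have eE z := presents_rows z pr.
exists (I + K)%type, P, x, (fun j z => rows B Q z j), (fun i z => (z == inl i)%:R).
split; last first.
  exists (fun z => match z with inl i => b i | inr j => - e j end).
  split=> [//|z|d|c].
  - rewrite big_sumType /=; under [X in _ + X]eq_bigr do rewrite mulNrz.
    by rewrite sumrN eE subrr.
  - have [u ->] := pr_gen pr d.
    exists (fun z => match z with inl i => 0 | inr j => - u j end).
    rewrite big_sumType /= [X in _ = X + _]big1 ?add0r => [|i _]; last by rewrite mulr0z.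
    by apply: eq_bigr => j _; rewrite mulrNz mulNrz opprK.
  rewrite big_sumType /=; under [X in _ + X]eq_bigr do rewrite mulNrz.
  rewrite sumrN; under eq_bigr do rewrite -(pr_lift pr).
  rewrite -sum_mulrz_comp -sumrB; under eq_bigr do rewrite -mulrzBr.
  case/(pr_rel pr)=> v vE.
  exists (fun z => match z with inl i => c (inl i) | inr k => - v k end).
  case=> [i|j] /=.
    rewrite big_sumType /= [X in _ + X]big1 ?addr0 => [|k _]; last by rewrite mulr0.
    rewrite (bigD1 i) //= eqxx mulr1 big1 ?addr0 // => j ji.
    rewrite (_ : _ == _ = false) ?mulr0 //.
    by apply: contraNF ji => /eqP[->].
  rewrite big_sumType /=; under [X in _ + X]eq_bigr do rewrite mulNr.
  by rewrite sumrN -vE opprB addrC subrK.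
split=> // [c c0 j|u|i]; last by rewrite sum_mulrz_delta.
  have [|g gE] := presents_hom (c := c) pr; first by move=> k; exact: (c0 (inr k)).
  have [k k0 [w wE]] := tb (e j).
  have gb i : g (b i) = 0.
    rewrite -(pr_lift pr) raddf_sum_mulrz -[RHS](c0 (inl i)).
    by apply: eq_bigr => l _; rewrite gE mulrzz.
  have /eqP := congr1 g wE; rewrite raddf_sum_mulrz raddfMn gE big1.
    by rewrite mulrn_eq0 -leqn0 leqNgt k0 => /eqP.
  by move=> i _; rewrite gb mul0rz.
split=> [/exact //|[c cE]]; under eq_bigr do rewrite cE.
by rewrite sum_mulrz_comp big1 // => j _; rewrite rel mul0rz.
Qed.

Lemma gale_pair_resolution (I : finType) (N D : zmodType) (b : I -> N)
    (a : I -> D) (J : finType) (c : J -> N) :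
  gale_pair b a -> inhabited (resolution c).
Proof.
move=> [P [K [e [Q [B [[gen inj exact lift] _]]]]]].
have /choice[C CE] i := gen (c i).
by apply: (@presents_resolution _ _ _ _ _ e Q C); split.
Qed.

(** A relation among the [b i] lifts to an identity between rows of [B] and [Q]. Its coefficients
    annihilate the image of the transposed matrix, so they define a functional on the cokernel
    [D]. *)
Lemma gale_pair_relP (I : finType) (N D : zmodType) (b : I -> N) (a : I -> D)
    (c : I -> int) : gale_pair b a ->
  \sum_i b i *~ c i = 0 <-> exists g : {additive D -> int}, forall i, g (a i) = c i.
Proof.
move=> [P [K [e [Q [B [pr [x [xa rel gen exact]]]]]]]].
under eq_bigr do rewrite -(pr_lift pr); rewrite -sum_mulrz_comp; split.
  case/(pr_rel pr)=> v vE.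
  pose w z := match z with inl i => c i | inr k => - v k end.
  have [u /exact[phi uE]|g gE] := additive_of_gens (y := w) gen.
    under eq_bigr do rewrite uE; rewrite sum_mulrz_comp big1 // => j _.
    under eq_bigr do rewrite mulrzz; rewrite big_sumType /= vE.
    by under [X in _ + X]eq_bigr do rewrite mulNr; rewrite sumrN subrr mul0rz.
  by exists g => i; rewrite -xa gE.
case=> g gE; apply/(pr_rel pr); exists (fun k => - g (x (inr k))) => j.
have /eqP := congr1 g (rel j); rewrite raddf_sum_mulrz raddf0 big_sumType /=.
rewrite addr_eq0 => /eqP; under eq_bigr do rewrite xa gE mulrzz.
by move=> ->; rewrite -sumrN; apply: eq_bigr => k _; rewrite mulrzz mulNr.
Qed.

(** * Inverses and dual functionals up to a common denominator *)

Lemma rat_common_denom (I : finType) (f : I -> rat) :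
  exists2 d : int, 0 < d & exists w : I -> int, forall i, f i * d%:~R = (w i)%:~R.
Proof.
exists (\prod_i denq (f i)); first by apply: prodr_gt0 => i _; apply: denq_gt0.
exists (fun i => numq (f i) * \prod_(j | j != i) denq (f j)) => i.
rewrite (bigD1 i) //= !intrM mulrA; congr (_ * _).
by rewrite numqE.
Qed.

(** Clearing denominators in a kernel vector shows that [Q] stays injective over the rationals; [G]
    is a rational inverse multiplied by its common denominator [d]. *)
Lemma int_left_inverse (K P : finType) (Q : K -> P -> int) :
  (forall c : K -> int, (forall j, \sum_k c k * Q k j = 0) -> forall k, c k = 0) ->
  exists2 d : int, 0 < d & exists G : P -> K -> int,
    forall k k', \sum_j Q k j * G j k' = (k == k')%:R * d.
Proof.
move=> Qinj.
pose A : 'M[rat]_(#|K|, #|P|) := \matrix_(k, j) (Q (enum_val k) (enum_val j))%:~R.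
have /row_freeP[X AX] : row_free A.
  apply: inj_row_free => v vA.
  have [d d0 [w wE]] := rat_common_denom (fun k => v 0 k).
  have w0 k : w (enum_rank k) = 0.
    apply: (Qinj (fun k => w (enum_rank k))) => j.
    move/matrixP/(_ 0 (enum_rank j)): vA; rewrite !mxE.
    move/(congr1 (fun y => y * d%:~R)); rewrite mul0r mulr_suml => vA0.
    apply: (@intr_inj rat); rewrite -[RHS]vA0 rmorph_sum /=.
    rewrite [RHS](reindex enum_rank) /=; last exact/onW_bij/enum_rank_bij.
    by apply: eq_bigr => k' _; rewrite intrM -wE !mxE !enum_rankK mulrAC.
  apply/rowP => k; rewrite mxE; apply: (@mulIf _ d%:~R).
    by rewrite intr_eq0 gt_eqF.
  by rewrite wE mul0r -[k]enum_valK w0.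
have [d d0 [w wE]] := rat_common_denom (fun jk : 'I_#|P| * 'I_#|K| => X jk.1 jk.2).
exists d => //; exists (fun j k => w (enum_rank j, enum_rank k)) => k k'.
apply: (@intr_inj rat); rewrite rmorph_sum /= intrM.
move/matrixP/(_ (enum_rank k) (enum_rank k')): AX; rewrite !mxE.
rewrite (inj_eq enum_rank_inj) => /(congr1 (fun y => y * d%:~R)).
rewrite rmorph_nat => <-; rewrite mulr_suml.
rewrite [RHS](reindex enum_rank) /=; last exact/onW_bij/enum_rank_bij.
by apply: eq_bigr => j _; rewrite intrM -wE !mxE !enum_rankK mulrA.
Qed.

(** Weighting the relations of [D] by a column of the inverse of [Q] up to [d] isolates
    [x (inr k) *~ d] and expresses it in the [a i]. *)
Lemma gale_pair_coker (I : finType) (N D : zmodType) (b : I -> N) (a : I -> D) :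
  gale_pair b a -> torsion_coker a.
Proof.
move=> [P [K [e [Q [B [pr [x [xa rel gen exact]]]]]]]] y.
have [d d0 [G GE]] := int_left_inverse (pr_inj pr).
have yk k : exists c : I -> int, x (inr k) *~ d = \sum_i a i *~ c i.
  exists (fun i => - \sum_j B i j * G j k).
  have : \sum_j (\sum_z x z *~ rows B Q z j) *~ G j k = 0.
    by apply: big1 => j _; rewrite rel mul0rz.
  rewrite -(sum_mulrz_comp x (fun j z => rows B Q z j)) big_sumType /=.
  move/eqP; rewrite addrC addr_eq0 => /eqP.
  under eq_bigr do (under eq_bigr do rewrite mulrC); under eq_bigr do rewrite GE.
  rewrite (bigD1 k) //= eqxx mul1r big1 ?addr0 => [->|k' /negPf->]; last first.
    by rewrite mul0r mulr0z.
  rewrite -sumrN; apply: eq_bigr => i _; rewrite xa mulrNz; congr (- (_ *~ _)).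
  by apply: eq_bigr => j _; rewrite mulrC.
have /choice[c cE] := yk; have [u ->] := gen y.
exists `|d|%N; first by rewrite absz_gt0 gt_eqF.
exists (fun i => u (inl i) * d + \sum_k u (inr k) * c k i).
rewrite -[LHS]/(_ *~ (`|d|%N%:Z)) gez0_abs ?ltW // mulrz_suml big_sumType /=.
under [RHS]eq_bigr do rewrite mulrzDr; rewrite big_split /= sum_mulrz_comp.
by congr (_ + _); apply: eq_bigr => i _; rewrite ?xa ?mulrzA // -cE mulrzAC.
Qed.

Lemma extend_coeffs (W Z : finType) (iota : W -> Z) (c : W -> int) :
  injective iota -> exists c' : Z -> int, (forall w, c' (iota w) = c w) /\
    (forall z, (forall w, iota w <> z) -> c' z = 0).
Proof.
move=> iotaI.
exists (fun z => if [pick w | iota w == z] is Some w then c w else 0); split=> [w|z nz].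
  case: pickP => [w' /eqP/iotaI-> //|/(_ w)]; by rewrite eqxx.
by case: pickP => // w /eqP /nz.
Qed.

Definition int_indep (I : finType) (N : zmodType) (b : I -> N) (S : {set I}) :=
  forall c : I -> int, \sum_(i in S) b i *~ c i = 0 -> forall i, i \in S -> c i = 0.

Lemma presents_indep (I P K : finType) (N : zmodType) (b : I -> N) (e : P -> N)
    (Q : K -> P -> int) (B : I -> P -> int) (S : {set I})
    (c : {i | i \in S} + K -> int) :
  presents b e Q B -> int_indep b S ->
  (forall j, \sum_z c z * rows (fun u : {i | i \in S} => B (val u)) Q z j = 0) ->
  forall z, c z = 0.
Proof.
move=> pr indS c0.
have [c' [c'E _]] := extend_coeffs (fun u => c (inl u)) (@val_inj _ _ {i | i \in S}).
have S0 : \sum_(i in S) b i *~ c' i = 0.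
  rewrite big_sub; under eq_bigr do rewrite c'E -(pr_lift pr).
  rewrite -sum_mulrz_comp; apply/(pr_rel pr); exists (fun k => - c (inr k)) => j.
  have /eqP := c0 j; rewrite big_sumType /= addr_eq0 => /eqP->.
  by rewrite -sumrN; apply: eq_bigr => k _; rewrite mulNr.
have cl u : c (inl u) = 0 by rewrite -c'E; apply: indS => //; apply: valP.
case=> [//|k]; apply: (pr_inj pr (c := fun k => c (inr k))) => j.
rewrite -[RHS](c0 j) big_sumType /= [X in _ = X + _]big1 ?add0r // => u _.
by rewrite cl mul0r.
Qed.

(** A dual basis up to the factor [d]. A column of the inverse of the rows of [S] and [Q] together,
    taken at an index of [S], vanishes on [Q] and so descends to [N]. *)
Lemma gale_pair_functionals (I : finType) (N D : zmodType) (b : I -> N) (a : I -> D)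
    (S : {set I}) : gale_pair b a -> int_indep b S ->
  exists2 d : int, 0 < d & exists g : I -> {additive N -> int},
    forall i i', i \in S -> i' \in S -> g i (b i') = (i' == i)%:R * d.
Proof.
move=> [P [K [e [Q [B [pr _]]]]]] indS.
have [d d0 [G GE]] := int_left_inverse (fun c => presents_indep (c := c) pr indS).
exists d => //.
have gE i : exists g : {additive N -> int},
    i \in S -> forall i', i' \in S -> g (b i') = (i' == i)%:R * d.
  have [iS|niS] := boolP (i \in S); last by exists (\0 : {additive N -> int}).
  have [k|g gE] := presents_hom (c := fun j => G j (inl (exist _ i iS))) pr.
    have := GE (inr k) (inl (exist _ i iS)).
    rewrite mul0r => G0; rewrite -[RHS]G0; apply: eq_bigr => j _; exact: mulrC.
  exists g => _ i' i'S; rewrite -(pr_lift pr) raddf_sum_mulrz.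
  have := GE (inl (exist _ i' i'S)) (inl (exist _ i iS)).
  have -> : (inl (exist _ i' i'S) == inl (exist _ i iS) :> {i | i \in S} + K) =
    (i' == i) by [].
  by move=> <-; apply: eq_bigr => j _; rewrite gE mulrzz mulrC.
by have [g gP] := choice gE; exists g => i i' iS i'S; apply: gP.
Qed.

(** Rows of the quotient presentation: [tau] moves from the generators to the
    relations, and the indices in neither set are dropped. *)
Definition quot_rows (I K : finType) (tau Lk : {set I})
    (w : {i | i \in Lk} + ({i | i \in tau} + K)) : I + K :=
  match w with
  | inl u => inl (val u) | inr (inl u) => inl (val u) | inr (inr k) => inr k
  end.

(** One matrix serves both quotients. Adjoining the rows of [tau] to the relations presents [N'],
    and independence of [tau] keeps them independent. The matrix of the new pair is the old one
    without the rows outside [tau] and [Lk], so its cokernel is [D] divided by the corresponding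
    [a i]. *)
Lemma gale_pair_quot (I : finType) (N D N' D' : zmodType) (b : I -> N) (a : I -> D)
    (q : {additive N -> N'}) (phi : {additive D -> D'}) (tau Lk : {set I}) :
  gale_pair b a -> [disjoint tau & Lk] -> int_indep b tau ->
  (forall y, exists x, q x = y) ->
  (forall x, q x = 0 <-> exists c : I -> int, x = \sum_(i in tau) b i *~ c i) ->
  (forall y, exists x, phi x = y) ->
  (forall x, phi x = 0 <->
     exists c : I -> int, x = \sum_(i in ~: (tau :|: Lk)%SET) a i *~ c i) ->
  gale_pair (fun u : {i | i \in Lk} => q (b (val u)))
            (fun u : {i | i \in Lk} => phi (a (val u))).
Proof.
move=> [P [K [e [Q [B [pr [x [xa rel gen exact]]]]]]]].
move=> disj indT qsurj qker psurj pker.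
pose Q' := rows (fun u : {i | i \in tau} => B (val u)) Q.
pose B' (u : {i | i \in Lk}) := B (val u).
exists P, ({i | i \in tau} + K)%type, (q \o e), Q', B'.
have iotaI : injective (@quot_rows I K tau Lk).
  have dis i j : i \in tau -> j \in Lk -> i <> j.
    by move=> iT jL ij; have /pred0P/(_ i) := disj; rewrite /= iT ij jL.
  move=> [u|[u|k]] [w|[w|l]] //= [] //.
  - by move=> /val_inj->.
  - by move/esym/(dis _ _ (valP w) (valP u)).
  - by move/(dis _ _ (valP u) (valP w)).
  - by move=> /val_inj->.
  - by move=> ->.
have notrow i (w : {i | i \in Lk} + ({i | i \in tau} + K)) :
    i \in ~: (tau :|: Lk)%SET -> quot_rows w <> inl i :> I + K.
  rewrite !inE negb_or => /andP[iT iL].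
  case: w => [[j jL]|[[j jT]|k]] //= [ji]; first by case/negP: iL; rewrite -ji.
  by case/negP: iT; rewrite -ji.
have sumE (V : zmodType) (F : I + K -> V) : \sum_z F z =
    \sum_w F (@quot_rows I K tau Lk w) + \sum_(i in ~: (tau :|: Lk)%SET) F (inl i).
  have splitE (G : I -> V) : \sum_i G i = \sum_(i in Lk) G i +
      (\sum_(i in tau) G i + \sum_(i in ~: (tau :|: Lk)%SET) G i).
    rewrite addrA -bigU; last by rewrite disjoint_sym.
    rewrite [LHS](bigID (mem (tau :|: Lk)%SET)) /=.
    by congr (_ + _); apply: eq_bigl => i; rewrite !inE // orbC.
  rewrite !big_sumType /= splitE [X in X + _ + _]big_sub.
  rewrite [X in _ + (X + _) + _]big_sub -!addrA; congr (_ + (_ + _)).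
  by rewrite addrC.
have pullE (c : {i | i \in Lk} + ({i | i \in tau} + K) -> int) :
    exists c' : I + K -> int, (forall w, c' (quot_rows w) = c w) /\
      \sum_z x z *~ c' z = \sum_w x (quot_rows w) *~ c w.
  have [c' [c'E c'0]] := extend_coeffs c iotaI; exists c'; split=> //.
  rewrite sumE [X in _ + X]big1 ?addr0 => [|i iR].
    by apply: eq_bigr => w _; rewrite c'E.
  by rewrite c'0 ?mulr0z // => w; apply: notrow.
have rowsE w j : rows B' Q' w j = rows B Q (quot_rows w) j by case: w => [u|[u|k]].
split.
  split=> [y|c c0|u|u].
  - have [y' <-] := qsurj y; have [u ->] := pr_gen pr y'.
    by exists u; rewrite raddf_sum_mulrz.
  - exact: presents_indep pr indT c0.
  - rewrite -(raddf_sum_mulrz xpredT q) qker; split=> -[c].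
      have -> : \sum_(i in tau) b i *~ c i =
          \sum_j e j *~ \sum_(v : {i | i \in tau}) c (val v) * B (val v) j.
        rewrite sum_mulrz_comp big_sub; apply: eq_bigr => v _.
        by rewrite (pr_lift pr).
      move/eqP; rewrite -subr_eq0 -sumrB; under eq_bigr do rewrite -mulrzBr.
      move/eqP/(pr_rel pr) => [w wE].
      exists (fun z => match z with inl v => c (val v) | inr k => w k end) => j.
      by rewrite big_sumType /= -wE addrC subrK.
    move=> uE; have [c' [c'E _]] := extend_coeffs (fun v => c (inl v))
      (@val_inj _ _ {i | i \in tau}).
    exists c'; rewrite [RHS]big_sub; under [RHS]eq_bigr do rewrite c'E -(pr_lift pr).
    rewrite -sum_mulrz_comp; apply/eqP; rewrite -subr_eq0 -sumrB; apply/eqP.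
    under eq_bigr do rewrite -mulrzBr; apply/(pr_rel pr).
    exists (fun k => c (inr k)) => j.
    by rewrite uE big_sumType /= addrAC subrr add0r.
  by rewrite -(pr_lift pr) raddf_sum_mulrz.
exists (phi \o x \o @quot_rows I K tau Lk); split=> [u|j|y|c] /=.
- by rewrite xa.
- under eq_bigr do rewrite rowsE.
  rewrite -(raddf_sum_mulrz xpredT phi (fun w => x (quot_rows w))); apply/pker.
  have /eqP := rel j; rewrite sumE addr_eq0 => /eqP->.
  exists (fun i => - B i j); rewrite -sumrN.
  by apply: eq_bigr => i _; rewrite xa mulrNz.
- have [y' <-] := psurj y; have [c ->] := gen y'.
  exists (fun w => c (quot_rows w)); rewrite sumE raddfD raddf_sum_mulrz.
  suff -> : phi (\sum_(i in ~: (tau :|: Lk)%SET) x (inl i) *~ c (inl i)) = 0.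
    by rewrite addr0.
  by apply/pker; exists (fun i => c (inl i)); apply: eq_bigr => i _; rewrite xa.
rewrite -(raddf_sum_mulrz xpredT phi (fun w => x (quot_rows w))).
have [c' [c'E <-]] := pullE c => /pker[r rE].
(* Subtracting [r'] turns [c'] into a relation in [D] itself, without changing it on the rows that
   are kept. *)
pose r' (z : I + K) := match z with
  | inl i => if i \in ~: (tau :|: Lk)%SET then r i else 0 | inr k => 0 end.
have r'0 w : r' (@quot_rows I K tau Lk w) = 0.
  rewrite /r'; case wE: (quot_rows w) => [i|//].
  by case: ifP => // iR; case: (notrow i w iR).
have [|psi psiE] := exact (fun z => c' z - r' z).
  under eq_bigr do rewrite mulrzBr; rewrite sumrB rE; apply/eqP.
  rewrite subr_eq0; apply/eqP; rewrite big_sumType /= [X in _ = _ + X]big1 ?addr0.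
    rewrite big_mkcond; apply: eq_bigr => i _.
    by case: ifP => _; rewrite ?xa ?mulr0z.
  by move=> k _; rewrite mulr0z.
exists psi => w; under eq_bigr do rewrite rowsE.
by rewrite -psiE c'E r'0 subr0.
Qed.

(** * Finite cokernels *)

(** Pigeonhole: among the multiples of [x] by [0], ..., [size s], two have the same class in the
    cokernel. *)
Lemma finite_coker_torsion (I : finType) (N : zmodType) (b : I -> N) :
  finite_coker b -> torsion_coker b.
Proof.
move=> /finite_seqP[s sE] x.
pose q := to_quotg b [set: I]%SET.
pose t := [seq q (x *+ n) | n <- iota 0 (size s).+1].
have ts : {subset t <= s}.
  by move=> y _; have : [set: quotg b [set: I]%SET]%classic y by []; rewrite sE.
have /(uniqPn 0)[m [n [mn]]] : ~~ uniq t.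
  apply/negP => /uniq_leq_size/(_ ts).
  by rewrite size_map size_iota ltnn.
rewrite size_map size_iota => ns.
rewrite !(nth_map 0%N) ?size_iota // ?(ltn_trans mn) // !nth_iota // ?(ltn_trans mn) //.
rewrite !add0n => qmn; exists (n - m)%N; first by rewrite subn_gt0.
have /to_quotg_eq0[c cE] : to_quotg b [set: I]%SET (x *+ (n - m)) = 0.
  by rewrite mulrnBr ?(ltnW mn) // raddfB; apply/eqP; rewrite subr_eq0 eq_sym; apply/eqP.
by exists c; rewrite cE; apply: eq_bigl => i; rewrite inE.
Qed.

(** The product [m] of exponents killing the classes of the generators kills them all, so
    coefficients may be reduced modulo [m]. *)
Lemma torsion_finite_coker (I P : finType) (N : zmodType) (b : I -> N) (e : P -> N) :
  (forall x, exists u : P -> int, x = \sum_j e j *~ u j) ->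
  torsion_coker b -> finite_coker b.
Proof.
move=> gen tb; pose q : {additive _ -> _} := to_quotg b [set: I]%SET.
have qtors j : exists k : nat, (0 < k)%N /\ q (e j *+ k) = 0.
  have [k k0 [c cE]] := tb (e j); exists k; split=> //; apply/to_quotg_eq0.
  by exists c; rewrite cE; apply: eq_bigl => i; rewrite inE.
have [k kP] := choice qtors; pose m := (\prod_j k j)%N.
have m0 : (0 < m)%N by apply: prodn_gt0 => j; case: (kP j).
have mq j : q (e j) *+ m = 0.
  rewrite /m (bigD1 j) //= mulrnA; have := (kP j).2; rewrite raddfMn => ->.
  by rewrite mul0rn.
pose f (u : {ffun P -> 'I_m}) := q (\sum_j e j *+ u j).
rewrite /finite_coker; suff -> : [set: quotg b [set: I]%SET]%classic = range f.
  by apply: finite_image; apply: finite_finset.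
apply/seteqP; split=> // y _; have [x <-] := to_quotg_surj y; have [u ->] := gen x.
have um j : (`|(u j %% m)%Z| < m)%N.
  by rewrite -ltz_nat gez0_abs ?modz_ge0 ?ltz_pmod //; rewrite -lt0n.
exists [ffun j => Ordinal (um j)] => //; rewrite /f !raddf_sum; apply: eq_bigr => j _.
rewrite ffunE /= raddfMn pmulrn gez0_abs ?modz_ge0 //; last by rewrite -lt0n.
rewrite [in RHS](divz_eq (u j) m) [RHS]raddfMz [RHS]mulrzDr.
by rewrite [X in _ *~ X + _]mulrC mulrzA -[q _ *~ m]pmulrn mq mul0rz add0r.
Qed.

(** * Real combinations *)

Section Real.
Variable R : realType.

Section Bar.
Variable N : zmodType.

Lemma bar_zmod_morphism : zmod_morphism (@bar R N).
Proof. by move=> x y; apply/funext => f; rewrite /bar raddfB intrB. Qed.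

HB.instance Definition _ :=
  GRing.isZmodMorphism.Build N ({additive N -> int} -> R^o) (@bar R N)
    bar_zmod_morphism.

Lemma barMz (x : N) (n : int) : bar R (x *~ n) = n%:~R *: bar R x.
Proof. by rewrite raddfMz scaler_int. Qed.

Lemma bar_comp (N' : zmodType) (phi : {additive N -> N'}) (x : N)
    (f : {additive N' -> int}) :
  bar R (phi x) f = bar R x (f \o phi : {additive N -> int}).
Proof. by []. Qed.

End Bar.

(** Coefficients live on all of [I], with supports tracked by [supp], so that combinations over
    different subsets can be added and compared. *)
Definition rcomb (I : finType) (N : zmodType) (b : I -> N) (lam : I -> R) :=
  \sum_i lam i *: bar R (b i).

Section Rcomb.
Variables (I : finType) (N : zmodType) (b : I -> N).

Lemma rcombE lam f : rcomb b lam f = \sum_i lam i * (f (b i))%:~R.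
Proof. by rewrite /rcomb fct_sumE. Qed.

Lemma rcombB lam mu : rcomb b (fun i => lam i - mu i) = rcomb b lam - rcomb b mu.
Proof. by rewrite /rcomb -sumrB; apply: eq_bigr => i _; rewrite scalerBl. Qed.

Lemma rcombD lam mu : rcomb b (fun i => lam i + mu i) = rcomb b lam + rcomb b mu.
Proof. by rewrite /rcomb -big_split; apply: eq_bigr => i _; rewrite scalerDl. Qed.

Lemma rcombZ t lam : rcomb b (fun i => t * lam i) = t *: rcomb b lam.
Proof. by rewrite /rcomb scaler_sumr; apply: eq_bigr => i _; rewrite scalerA. Qed.

Lemma rcomb0 : rcomb b (fun=> 0) = 0.
Proof. by rewrite /rcomb big1 // => i _; rewrite scale0r. Qed.

Lemma rcomb_eq0B lam mu :
  rcomb b lam = rcomb b mu <-> rcomb b (fun i => lam i - mu i) = 0.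
Proof. by rewrite rcombB; split=> [->|/eqP]; rewrite ?subrr // subr_eq0 => /eqP. Qed.

Lemma rcomb_delta i : rcomb b (fun j => (j == i)%:R) = bar R (b i).
Proof.
rewrite /rcomb (bigD1 i) //= eqxx scale1r big1 ?addr0 // => j /negPf->.
by rewrite scale0r.
Qed.

Lemma rcomb_int (c : I -> int) :
  rcomb b (fun i => (c i)%:~R) = bar R (\sum_i b i *~ c i).
Proof. by rewrite raddf_sum; apply: eq_bigr => i _; exact/esym/barMz. Qed.

Definition supp (lam : I -> R) (S : {set I}) := forall i, i \notin S -> lam i = 0.

Lemma rcomb_supp lam (S : {set I}) : supp lam S ->
  rcomb b lam = \sum_(i in S) lam i *: bar R (b i).
Proof.
move=> lamS; rewrite /rcomb (bigID (mem S)) /= [X in _ + X]big1 ?addr0 // => i iS.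
by rewrite lamS // scale0r.
Qed.

Lemma restr_supp lam (S : {set I}) : supp (fun i => if i \in S then lam i else 0) S.
Proof. by move=> i /negPf->. Qed.

Lemma rcomb_restr lam (S : {set I}) :
  rcomb b (fun i => if i \in S then lam i else 0) =
  \sum_(i in S) lam i *: bar R (b i).
Proof.
rewrite (rcomb_supp (@restr_supp lam S)); apply: eq_bigr => i ->.
by [].
Qed.

End Rcomb.

Lemma rspanD (V : lmodType R) (S : set V) x y :
  rspan S x -> rspan S y -> rspan S (x + y).
Proof.
move=> [n [c [v [Sv ->]]]] [m [d [w [Sw ->]]]].
exists (n + m)%N, (fun i => match fintype.split i with inl j => c j | inr j => d j end).
exists (fun i => match fintype.split i with inl j => v j | inr j => w j end); split.
  by move=> i; case: (fintype.split i).
rewrite big_split_ord /=; congr (_ + _); apply: eq_bigr => i _.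
  by have -> : fintype.split (lshift m i) = inl i by exact: (unsplitK (inl i)).
by have -> : fintype.split (rshift n i) = inr i by exact: (unsplitK (inr i)).
Qed.

Lemma rspanZ (V : lmodType R) (S : set V) t x : rspan S x -> rspan S (t *: x).
Proof.
move=> [n [c [v [Sv ->]]]]; exists n, (fun i => t * c i), v; split=> //.
by rewrite scaler_sumr; apply: eq_bigr => i _; rewrite scalerA.
Qed.

Lemma rspan_sub (V : lmodType R) (S : set V) x : S x -> rspan S x.
Proof.
move=> Sx; exists 1%N, (fun=> 1), (fun=> x); split=> //.
by rewrite big_ord1 scale1r.
Qed.

Lemma rspan0 (V : lmodType R) (S : set V) : rspan S 0.
Proof. by exists 0%N, (fun=> 0), (fun=> 0); split=> [[] //|]; rewrite big_ord0. Qed.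

Lemma rspan_min (V : lmodType R) (S W : set V) :
  (forall x, S x -> W x) -> W 0 -> (forall x y, W x -> W y -> W (x + y)) ->
  (forall t x, W x -> W (t *: x)) -> forall x, rspan S x -> W x.
Proof.
move=> SW W0 WD WZ x [n [c [v [Sv ->]]]].
by elim/big_ind: _ => // i _; apply/WZ/SW.
Qed.

Section Families.
Variables (I : finType) (N : zmodType) (b : I -> N).

Lemma family_spanP (S : {set I}) v :
  family_span R b S v <-> exists lam, supp lam S /\ v = rcomb b lam.
Proof.
split.
  apply: (rspan_min (W := fun v => exists lam, supp lam S /\ v = rcomb b lam)).
  - move=> _ [i iS ->]; exists (fun j => (j == i)%:R); rewrite rcomb_delta; split=> // j.
    by apply: contraNeq; rewrite pnatr_eq0 eqb0 negbK => /eqP->.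
  - by exists (fun=> 0); rewrite rcomb0.
  - move=> _ _ [lam [lS ->]] [mu [mS ->]]; exists (fun i => lam i + mu i).
    by rewrite rcombD; split=> // i iS; rewrite lS // mS // addr0.
  - move=> t _ [lam [lS ->]]; exists (fun i => t * lam i).
    by rewrite rcombZ; split=> // i iS; rewrite lS // mulr0.
move=> [lam [lS ->]]; rewrite (rcomb_supp _ lS).
apply: (big_ind (family_span R b S)) => [|x y|i iS].
- exact: rspan0.
- exact: rspanD.
by apply/rspanZ/rspan_sub; exists i.
Qed.

Lemma lin_indepP (S : {set I}) :
  lin_indep R b S <-> forall lam, supp lam S -> rcomb b lam = 0 -> forall i, lam i = 0.
Proof.
split=> [indS lam lS|indS lam l0 i iS].
  rewrite (rcomb_supp _ lS) => /indS l0 i.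
  by have [/l0|/lS] := boolP (i \in S).
have := indS _ (@restr_supp _ lam S); rewrite rcomb_restr => /(_ l0 i).
by rewrite iS.
Qed.

Definition spans (S : {set I}) :=
  forall mu, exists lam, supp lam S /\ rcomb b mu = rcomb b lam.

Lemma real_spaceP : torsion_coker b -> forall v,
  real_space R N v <-> exists lam, v = rcomb b lam.
Proof.
move=> tb v; split.
  apply: (rspan_min (W := fun v => exists lam, v = rcomb b lam)).
  - move=> _ [x _ <-]; have [k k0 [c cE]] := tb x.
    exists (fun i => k%:R^-1 * (c i)%:~R); rewrite rcombZ rcomb_int -cE raddfMn.
    by rewrite -scaler_nat scalerA mulVf ?scale1r // pnatr_eq0 -lt0n.
  - by exists (fun=> 0); rewrite rcomb0.
  - by move=> _ _ [lam ->] [mu ->]; exists (fun i => lam i + mu i); rewrite rcombD.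
  - by move=> t _ [lam ->]; exists (fun i => t * lam i); rewrite rcombZ.
move=> [lam ->]; apply: (big_ind (real_space R N)) => [|x y|i _].
- exact: rspan0.
- exact: rspanD.
by apply/rspanZ/rspan_sub; exists (b i).
Qed.

Lemma family_span_real (S : {set I}) v : family_span R b S v -> real_space R N v.
Proof.
apply: rspan_min => [_ [i _ ->]||x y|t x].
- by apply: rspan_sub; exists (b i).
- exact: rspan0.
- exact: rspanD.
exact: rspanZ.
Qed.

Lemma family_span_full (S : {set I}) : torsion_coker b ->
  family_span R b S = real_space R N <-> spans S.
Proof.
move=> tb; split=> [SE mu|spS].
  apply/family_spanP; rewrite SE; apply/real_spaceP => //; by exists mu.
apply/seteqP; split=> v; first exact: family_span_real.
by move/(real_spaceP tb) => [mu ->]; apply/family_spanP.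
Qed.

Lemma basisP (C : {set I}) : torsion_coker b ->
  is_basis R b C <-> lin_indep R b C /\ spans C.
Proof. by move=> tb; rewrite /is_basis family_span_full. Qed.

Lemma hyperplaneP (S : {set I}) : torsion_coker b ->
  is_hyperplane (real_space R N) (family_span R b S) <->
  ~ spans S /\ exists xi, forall mu, exists lam (t : R),
    supp lam S /\ rcomb b mu = rcomb b lam + t *: rcomb b xi.
Proof.
move=> tb; split.
  move=> [SW /family_span_full-/(_ tb) nS [_ /(real_spaceP tb)[xi ->] spS]].
  split=> //; exists xi => mu.
  have : real_space R N (rcomb b mu) by apply/(real_spaceP tb); exists mu.
  rewrite -spS; apply: (rspan_min (W := fun v => exists lam (t : R),
    supp lam S /\ v = rcomb b lam + t *: rcomb b xi)).
  - move=> _ [/family_spanP[lam [lS ->]]|->].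
      by exists lam, 0; rewrite scale0r addr0.
    by exists (fun=> 0), 1; rewrite scale1r rcomb0 add0r.
  - by exists (fun=> 0), 0; rewrite scale0r rcomb0 addr0.
  - move=> _ _ [lam [t [lS ->]]] [lam' [t' [lS' ->]]].
    exists (fun i => lam i + lam' i), (t + t'); split.
      by move=> i iS; rewrite lS // lS' // addr0.
    by rewrite rcombD scalerDl addrACA.
  - move=> u _ [lam [t [lS ->]]]; exists (fun i => u * lam i), (u * t); split.
      by move=> i iS; rewrite lS // mulr0.
    by rewrite rcombZ scalerDr scalerA.
move=> [nS [xi spS]]; split; first by move=> v; apply: family_span_real.
  by move/(family_span_full _ tb).
exists (rcomb b xi); first by apply/(real_spaceP tb); exists xi.
apply/seteqP; split=> v.
  apply: rspan_min => [x [|->]||x y|t x].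
  - exact: family_span_real.
  - by apply/(real_spaceP tb); exists xi.
  - exact: rspan0.
  - exact: rspanD.
  - exact: rspanZ.
move/(real_spaceP tb) => [mu ->]; have [lam [t [lS ->]]] := spS mu.
apply: rspanD; first by apply: rspan_sub; left; apply/family_spanP; exists lam.
by apply/rspanZ/rspan_sub; right.
Qed.

(** A spanning subset of least cardinality is independent, since a relation with [lam i != 0] would
    allow [i] to be dropped. *)
Lemma spans_basis (S : {set I}) : spans S ->
  exists C : {set I}, [/\ C \subset S, lin_indep R b C & spans C].
Proof.
move=> spS; pose P (C : {set I}) := (C \subset S) && `[< spans C >].
have PS : P S by rewrite /P subxx; apply/asboolP.
have [C /andP[CS /asboolP spC] minC] := arg_minnP (fun C : {set I} => #|C|) PS.
exists C; split=> //; apply/lin_indepP => lam lC l0 i.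
have [//|li] := eqVneq (lam i) 0.
have iC : i \in C by apply: contraNT li => /lC->.
suff : P (C :\ i)%SET by move/minC; rewrite (cardsD1 i C) iC ltnn.
apply/andP; split; first by apply: (fintype.subset_trans _ CS); apply: finset.subsetDl.
apply/asboolP => mu; have [nu [nC ->]] := spC mu.
exists (fun j => nu j - nu i / lam i * lam j); split.
  move=> j; rewrite !inE negb_and negbK => /orP[/eqP->|jC].
    by rewrite divfK // subrr.
  by rewrite (lC _ jC) (nC _ jC) mulr0 subr0.
by rewrite rcombB rcombZ l0 scaler0 subr0.
Qed.

Lemma lin_indep_int (S : {set I}) : lin_indep R b S -> int_indep b S.
Proof.
move=> /lin_indepP indS c c0 i iS; apply/eqP; rewrite -(intr_eq0 R).
have := indS _ (@restr_supp _ (fun i => (c i)%:~R) S); rewrite rcomb_restr.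
have -> : \sum_(i in S) (c i)%:~R *: bar R (b i) = 0.
  rewrite -[RHS](raddf0 (@bar R N)) -[in RHS]c0 raddf_sum.
  by apply: eq_bigr => j _; apply/esym/barMz.
by move=> /(_ erefl i); rewrite iS => ->.
Qed.

End Families.

(** * Gale dual families over the reals *)

Section GaleFamilies.
Variables (I : finType) (N D : zmodType) (b : I -> N) (a : I -> D).
Hypothesis ba : gale_pair b a.

(** [D_R] consists of functions on the functionals of [D], and by [gale_pair_relP] those are the
    integer relations among the [b i]. *)
Lemma rcomb_gale (lam : I -> R) : rcomb a lam = 0 <->
  forall c : I -> int, \sum_i b i *~ c i = 0 -> \sum_i lam i * (c i)%:~R = 0.
Proof.
split=> [l0 c /(gale_pair_relP c ba)[g gE]|l0].
  have := congr1 (fun v => v g) l0; rewrite rcombE.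
  by under eq_bigr do rewrite gE.
apply/funext => g; rewrite rcombE; apply: l0.
by apply/(gale_pair_relP _ ba); exists g.
Qed.

(** Evaluation at the dual functionals isolates a nonzero multiple of each real coefficient. *)
Lemma int_indep_lin (S : {set I}) : int_indep b S -> lin_indep R b S.
Proof.
move=> /(gale_pair_functionals ba)[d d0 [g gE]] lam l0 i iS.
move/(congr1 (fun v => v (g i))): l0; rewrite -rcomb_restr rcombE (bigD1 i) //=.
rewrite iS gE // eqxx mul1r big1 ?addr0 => [/eqP|j /negPf ji].
  by rewrite mulf_eq0 intr_eq0 (gt_eqF d0) orbF => /eqP.
by case: ifP => jS; rewrite ?mul0r // gE // ji mul0r mulr0.
Qed.

Lemma spans_setC (S : {set I}) : int_indep b S -> spans a (~: S)%SET.
Proof.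
move=> /(gale_pair_functionals ba)[d d0 [g gE]] mu.
have dn0 : d%:~R != 0 :> R by rewrite intr_eq0 gt_eqF.
(* For a functional [g] on [N], the vector of the [g (b i)] annihilates every relation among the
   [b i], so it is a relation among the [a i]. [nu] is the combination of such vectors that agrees
   with [mu] on [S]. *)
pose nu i := \sum_(j in S) mu j / d%:~R * (g j (b i))%:~R.
exists (fun i => mu i - nu i); split.
  move=> i; rewrite inE negbK => iS; rewrite /nu (bigD1 i) //= gE // eqxx mul1r.
  rewrite divfK // big1 ?addr0 ?subrr // => j /andP[jS /negPf ji].
  by rewrite gE // eq_sym ji mul0r mulr0.
rewrite rcombB -[LHS]subr0; congr (_ - _); apply/esym/rcomb_gale => c c0.
rewrite /nu; under eq_bigr do rewrite mulr_suml.
rewrite exchange_big big1 //= => j _; under eq_bigr do rewrite -mulrA.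
rewrite -mulr_sumr (_ : \sum_i _ = 0) ?mulr0 //.
have /(congr1 (fun n : int => n%:~R : R)) := congr1 (g j) c0.
rewrite raddf_sum_mulrz raddf0 rmorph_sum /= => cj0; rewrite -[RHS]cj0.
by apply: eq_bigr => i _; rewrite mulrzz rmorphM.
Qed.

End GaleFamilies.

Lemma rcomb_push (I : finType) (N N' : zmodType) (phi : {additive N -> N'})
    (b : I -> N) (x : N) (lam : I -> R) :
  bar R x = rcomb b lam -> bar R (phi x) = rcomb (phi \o b) lam.
Proof.
move=> xE; apply/funext => f; rewrite bar_comp xE !rcombE.
by apply: eq_bigr.
Qed.

End Real.

(** * The quotient arrangement *)

Lemma sum_sub_supp (V : zmodType) (I : finType) (L : {set I}) (G : I -> V) :
  (forall i, i \notin L -> G i = 0) -> \sum_i G i = \sum_(u : {i | i \in L}) G (val u).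
Proof.
move=> G0; transitivity (\sum_(i in L) G i); last exact: big_sub.
by rewrite (bigID (mem L)) /= [X in _ + X]big1 ?addr0 // => i /G0.
Qed.

Section QuotientArrangement.
Variables (R : realType) (I : finType) (N D : zmodType) (b : I -> N) (a : I -> D).
Variable F : {set I}.
Hypotheses (ba : gale_pair b a) (tb : torsion_coker b) (indF : lin_indep R b F).

Local Notation L := (mf_link R b F).
Local Notation J := (~: (F :|: L))%SET.

Definition quot_b (u : {i | i \in L}) : quotg b F := to_quotg b F (b (val u)).

Lemma mem_link i : (i \in L) = (i \notin F) && `[< lin_indep R b (i |: F)%SET >].
Proof. by rewrite inE. Qed.

Lemma link_disjoint : [disjoint F & L].
Proof. by apply/pred0P => i /=; rewrite mem_link andbA andbN. Qed.

Lemma restE i : (i \in J) = (i \notin F) && (i \notin L).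
Proof. by rewrite finset.in_setC finset.in_setU negb_or. Qed.

Lemma link_trichotomy i : [\/ i \in F, i \in L | i \in J].
Proof.
have [iF|iF] := boolP (i \in F); first by constructor 1.
have [iL|iL] := boolP (i \in L); first by constructor 2.
by constructor 3; rewrite restE iF iL.
Qed.

Lemma link_notin_F i : i \in L -> i \notin F.
Proof. by rewrite mem_link => /andP[]. Qed.

Lemma link_cone i : i \in L -> lin_indep R b (i |: F)%SET.
Proof. by rewrite mem_link => /andP[_ /asboolP]. Qed.

(** As [F] is independent and [j |: F] is not, some relation on [j |: F] involves [j]; it can be
    taken integral by [int_indep_lin]. *)
Lemma rest_circuit j : j \in J -> exists c : I -> int,
  [/\ \sum_i b i *~ c i = 0, c j != 0 & forall i, i \notin F -> i != j -> c i = 0].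
Proof.
rewrite restE mem_link => /andP[jF]; rewrite jF /= => /asboolPn.
move=> nind; apply: contrapT => nc; apply: nind.
apply/(int_indep_lin ba) => c c0.
pose c' i := if i \in (j |: F)%SET then c i else 0.
have c'0 : \sum_i b i *~ c' i = 0.
  rewrite -[RHS]c0 [RHS]big_mkcond; apply: eq_bigr => i _.
  by rewrite /c'; case: ifP; rewrite ?mulr0z.
have cj : c j = 0.
  apply/eqP; apply: contrapT => /negP cj; apply: nc; exists c'; split=> //.
    by rewrite /c' setU11.
  by move=> i iF ij; rewrite /c' !inE (negPf ij) (negPf iF).
move: c0; rewrite (big_setD1 j) ?setU11 //= cj mulr0z add0r setU1K //.
move/(lin_indep_int indF) => cF i; rewrite !inE => /orP[/eqP->//|]; exact: cF.
Qed.

(** The circuit at [j] is supported on [F] and [j]. After scaling by the product [m] of their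
    leading coefficients, the circuits clear all coordinates on [J], while those on [L] are only
    scaled. *)
Lemma eliminate_rest : exists2 m : int, m != 0 & forall c : I -> int,
  exists c' : I -> int, [/\ \sum_i b i *~ c' i = (\sum_i b i *~ c i) *~ m,
    forall i, i \in L -> c' i = c i * m & forall j, j \in J -> c' j = 0].
Proof.
have ex j : exists c : I -> int, j \in J ->
    [/\ \sum_i b i *~ c i = 0, c j != 0 & forall i, i \notin F -> i != j -> c i = 0].
  have [/rest_circuit[c cP]|] := boolP (j \in J); first by exists c.
  by exists (fun=> 0).
have [u uP] := choice ex.
pose m := \prod_(j in J) u j j; exists m.
  by apply/prodf_neq0 => j /uP[].
(* [w j] is [c j * m / u j j], written without division. *)
move=> c; pose w j := c j * \prod_(l in J | l != j) u l l.
exists (fun i => c i * m - \sum_(j in J) w j * u j i); split.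
- under eq_bigr do rewrite mulrzBr; rewrite sumrB -[RHS]subr0; congr (_ - _).
    by rewrite mulrz_suml; apply: eq_bigr => i _; rewrite mulrzA.
  under eq_bigr do rewrite mulrz_sumr; rewrite exchange_big big1 //= => j jJ.
  have [uj0 _ _] := uP j jJ; rewrite -[RHS](mul0rz _ (w j)) -[in RHS]uj0 mulrz_suml.
  by apply: eq_bigr => i _; rewrite mulrC mulrzA.
- move=> i iL; rewrite big1 ?subr0 // => j jJ; have [_ _ uj] := uP j jJ.
  rewrite uj ?mulr0 ?link_notin_F //; apply: contraTneq iL => ->.
  by move: jJ; rewrite restE => /andP[].
move=> j jJ; rewrite (bigD1 j) //= big1 ?addr0 => [|l /andP[lJ lj]].
  by rewrite /m (bigD1 j) //= /w mulrAC mulrA subrr.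
have [_ _ ul] := uP l lJ; rewrite ul ?mulr0 //; last by rewrite eq_sym.
by move: jJ; rewrite restE => /andP[].
Qed.

Lemma quot_b_sum (c : I -> int) : (forall j, j \in J -> c j = 0) ->
  to_quotg b F (\sum_i b i *~ c i) = \sum_u quot_b u *~ c (val u).
Proof.
move=> cJ; rewrite raddf_sum_mulrz (sum_sub_supp (L := L)) // => i iL.
case: (link_trichotomy i) => [iF|iL'|/cJ->]; last by rewrite mulr0z.
  suff bi0 : to_quotg b F (b i) = 0 by rewrite -[RHS](mul0rz _ (c i)) -bi0.
  apply/to_quotg_eq0; exists (fun j => (j == i)%:R).
  rewrite (bigD1 i) //= eqxx big1 ?addr0 // => j.
  by case/andP=> _ /negPf->; rewrite mulr0z.
by rewrite iL' in iL.
Qed.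

Lemma quot_b_torsion_coker : torsion_coker quot_b.
Proof.
move=> y; have [x <-] := to_quotg_surj y; have [k k0 [c cE]] := tb x.
have [m m0 /(_ c)[c' [c'E _ c'J]]] := eliminate_rest.
exists (k * `|m|)%N; first by rewrite muln_gt0 k0 absz_gt0.
(* The multiplier has to be a natural number, so the sign of [m] moves into the coefficients. *)
exists (fun u => Num.sg m * c' (val u)).
have mE : to_quotg b F x *+ k *~ m = \sum_u quot_b u *~ c' (val u).
  by rewrite -quot_b_sum // c'E -cE raddfMz raddfMn.
rewrite mulrnA pmulrn abszEsg mulrC mulrzA mE mulrz_suml.
by apply: eq_bigr => u _; rewrite mulrC mulrzA.
Qed.

Lemma quot_b_nontorsion u : nontorsion (quot_b u).
Proof.
move=> k k0 /eqP; rewrite -raddfMn => /eqP/to_quotg_eq0[c cE].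
have /lin_indep_int ind := link_cone (valP u).
have uF := link_notin_F (valP u).
suff : k%:Z = 0 by case=> k00; rewrite k00 in k0.
have := ind (fun i => if i == val u then k%:Z else - c i) _ (val u).
rewrite eqxx setU11; apply=> //; rewrite big_setU1 //= eqxx -pmulrn cE.
rewrite -big_split big1 //= => i iF.
by rewrite ifN ?mulrNz ?subrr //; apply: contraNneq uF => iu; rewrite iu in iF.
Qed.

Variables (D' : zmodType) (a' : {i | i \in L} -> D') (phi : {additive D -> D'}).
Hypotheses (ba' : gale_pair quot_b a') (phi_a : forall u, phi (a (val u)) = a' u).
Hypothesis phi_rest : forall j, j \in J -> phi (a j) = 0.

(** The normal form for coefficients on [a]: every combination has one by [off_F_rep], and its
    values on [L] are coordinates for [a']. *)
Definition off_F (nu : I -> R) := forall i, i \in F -> nu i = 0.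

Lemma push_rcomb x nu : off_F nu -> bar R x = rcomb a nu ->
  bar R (phi x) = rcomb a' (fun u => nu (val u)).
Proof.
move=> nuF /(rcomb_push phi)->; rewrite /rcomb (sum_sub_supp (L := L)).
  by apply: eq_bigr => u _ /=; rewrite phi_a.
move=> i iL; case: (link_trichotomy i) => [/nuF->|iL'|/phi_rest /=->].
- exact: scale0r.
- by rewrite iL' in iL.
by rewrite raddf0 scaler0.
Qed.

(** The span of the [a j], [j \in J], splits off. The circuit at [j] meets the support of [nu] at
    most at [j], which forces [nu j = 0]. Conversely, relations among the [b i] cleared on [J]
    descend to relations among the [quot_b u], against which the part of [nu] on [L] is tested. *)
Lemma rcomb_quot nu : off_F nu -> rcomb a nu = 0 <->
  (forall j, j \in J -> nu j = 0) /\ rcomb a' (fun u => nu (val u)) = 0.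
Proof.
move=> nuF; split=> [nu0|[nuJ nu0]].
  split; last by rewrite -(@push_rcomb 0) ?raddf0 // nu0.
  move=> j /rest_circuit[c [c0 cj cF]].
  have /(rcomb_gale ba)/(_ c c0) := nu0; rewrite (bigD1 j) //= big1.
    by rewrite addr0 => /eqP; rewrite mulf_eq0 intr_eq0 (negPf cj) orbF => /eqP.
  move=> i ij; have [/nuF->|iF] := boolP (i \in F); first exact: mul0r.
  by rewrite cF // mulr0.
apply/(rcomb_gale ba) => c c0; have [m m0 /(_ c)[c' [c'E c'L c'J]]] := eliminate_rest.
have /(rcomb_gale ba')/(_ (fun u => c' (val u))) := nu0.
rewrite -quot_b_sum // c'E c0 mul0rz raddf0 => /(_ erefl) nuc.
rewrite (sum_sub_supp (L := L)); last first.
  move=> i iL; case: (link_trichotomy i) => [/nuF->|iL'|/nuJ->]; rewrite ?mul0r //.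
  by rewrite iL' in iL.
apply: (@mulIf _ m%:~R); first by rewrite intr_eq0.
rewrite mul0r mulr_suml -[RHS]nuc; apply: eq_bigr => u _.
by rewrite c'L ?rmorphM ?mulrA //; apply: valP.
Qed.

Lemma rcomb_quotB lam mu : off_F lam -> off_F mu -> rcomb a lam = rcomb a mu <->
  (forall j, j \in J -> lam j = mu j) /\
  rcomb a' (fun u => lam (val u)) = rcomb a' (fun u => mu (val u)).
Proof.
move=> lF mF; rewrite !rcomb_eq0B rcomb_quot; last first.
  by move=> i iF; rewrite lF // mF // subr0.
by split=> -[lmJ lm]; split=> // j /lmJ; [move/eqP; rewrite subr_eq0 => /eqP
  | move->; rewrite subrr].
Qed.

Lemma off_F_rep mu : exists nu, off_F nu /\ rcomb a mu = rcomb a nu.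
Proof.
have [nu [nuF ->]] := spans_setC ba (lin_indep_int indF) mu.
by exists nu; split=> // i iF; apply: nuF; rewrite inE iF.
Qed.

Lemma glue (lam' : {i | i \in L} -> R) (rho : I -> R) : exists nu : I -> R,
  [/\ off_F nu, forall j, j \in J -> nu j = rho j & forall u, nu (val u) = lam' u].
Proof.
exists (fun i => if insub i is Some u then lam' u else if i \in J then rho i else 0).
split=> [i iF|j jJ|u].
- rewrite insubN ?restE ?iF //; apply: contraL iF => /link_notin_F //.
- by rewrite insubN ?jJ //; move: jJ; rewrite restE => /andP[].
by rewrite valK.
Qed.

Definition quot_set (S : {set I}) : {set {i | i \in L}} := [set u | val u \in S]%SET.
(** [J] is added because every spanning set disjoint from [F] contains it, by [spans_rest]. *)
Definition lift_set (S : {set {i | i \in L}}) : {set I} := (J :|: val @: S)%SET.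

Lemma lift_set_off_F S i : i \in F -> i \notin lift_set S.
Proof.
move=> iF; rewrite inE restE iF /=; apply/imsetP => -[u _ iu].
by case/negP: (link_notin_F (valP u)); rewrite /= in iu *; rewrite -iu.
Qed.

Lemma lift_set_rest S j : j \in J -> j \in lift_set S.
Proof. by move=> jJ; rewrite inE jJ. Qed.

Lemma mem_lift_set S u : (val u \in lift_set S) = (u \in S).
Proof.
rewrite inE restE (valP u) andbF /=; apply/imsetP/idP => [[w wS /val_inj->]//|uS].
by exists u.
Qed.

Lemma supp_lift S nu : off_F nu ->
  supp nu (lift_set S) <-> supp (fun u => nu (val u)) S.
Proof.
move=> nuF; split=> [nuS u uS|nuS i iS]; first by apply: nuS; rewrite mem_lift_set.
case: (link_trichotomy i) => [/nuF //|iL|/(lift_set_rest S)]; last by rewrite (negPf iS).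
by apply: (nuS (exist _ i iL)); rewrite -mem_lift_set.
Qed.

Lemma supp_off_F (S : {set I}) nu : [disjoint F & S] -> supp nu S -> off_F nu.
Proof. by move=> dFS nuS i iF; apply: nuS; rewrite (disjointFr dFS). Qed.

Lemma disjoint_lift S : [disjoint F & lift_set S].
Proof.
apply/pred0P => i /=; have [iF|//] := boolP (i \in F).
by rewrite (negPf (lift_set_off_F _ iF)).
Qed.

(** The coordinate at [j] is the same in all expressions off [F], so [a j] can only be expressed by
    a family that contains it. *)
Lemma spans_rest (C : {set I}) : [disjoint F & C] -> spans R a C -> J \subset C.
Proof.
move=> dFC spC; apply/fintype.subsetP => j jJ.
have [lam [lC]] := spC (fun i => (i == j)%:R).
rewrite rcomb_quotB; last exact: supp_off_F lC.
  move=> [/(_ j jJ)]; rewrite eqxx => l1 _.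
  by apply: contraT => /lC l0; move: l1; rewrite l0 => /eqP; rewrite oner_eq0.
move=> i iF; rewrite (_ : i == j = false) //.
by apply: contraTF jJ => /eqP<-; rewrite restE iF.
Qed.

Lemma lift_quot_set (C : {set I}) : [disjoint F & C] -> J \subset C ->
  lift_set (quot_set C) = C.
Proof.
move=> dFC JC; apply/setP => i; case: (link_trichotomy i) => [iF|iL|iJ].
- by rewrite (negPf (lift_set_off_F _ iF)) (disjointFr dFC).
- by rewrite (mem_lift_set _ (exist _ i iL)) inE.
by rewrite lift_set_rest // (fintype.subsetP JC).
Qed.

Lemma spans_lift S : spans R a (lift_set S) <-> spans R a' S.
Proof.
have dFS := disjoint_lift S; split=> spS mu.
  have [nu [nuF _ nuE]] := glue mu (fun=> 0).
  have [lam [lS]] := spS nu; have lF := supp_off_F dFS lS.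
  rewrite rcomb_quotB // => -[_ E]; exists (fun u => lam (val u)); split.
    by apply/supp_lift.
  by rewrite -E; congr rcomb; apply/funext => u; rewrite nuE.
have [nu [nuF ->]] := off_F_rep mu.
have [lam' [lS E]] := spS (fun u => nu (val u)).
have [lam [lF lJ lE]] := glue lam' nu; exists lam.
have lE' : (fun u => lam (val u)) = lam' by apply/funext => u; rewrite lE.
split; first by apply/supp_lift; rewrite // lE'.
by rewrite rcomb_quotB // lE'; split=> // j jJ; rewrite lJ.
Qed.

Lemma lin_indep_lift S : lin_indep R a (lift_set S) <-> lin_indep R a' S.
Proof.
have dFS := disjoint_lift S; split=> /lin_indepP ind; apply/lin_indepP.
  move=> lam' lS l0 u; have [lam [lF lJ lE]] := glue lam' (fun=> 0).
  have lE' : (fun u => lam (val u)) = lam' by apply/funext => w; rewrite lE.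
  rewrite -lE; apply: ind; first by apply/supp_lift; rewrite // lE'.
  by apply/rcomb_quot; rewrite // lE'.
move=> lam lS; have lF := supp_off_F dFS lS.
rewrite rcomb_quot // => -[lJ l0] i.
case: (link_trichotomy i) => [/lF //|iL|/lJ //].
by apply: (ind (fun u => lam (val u)) _ _ (exist _ i iL)) => //; apply/supp_lift.
Qed.

(** For [u] in the link [u |: F] is independent, so its complement spans [D_R] and contains a
    basis. *)
Lemma basis_avoiding (u : {i | i \in L}) : exists C : {set I},
  [/\ [disjoint F & C], val u \notin C, lin_indep R a C & spans R a C].
Proof.
have sp := spans_setC (R := R) ba (lin_indep_int (link_cone (valP u))).
have [C [CS indC spC]] := spans_basis sp; exists C; split=> //.
  apply/pred0P => i /=; apply/negP => /andP[iF /(fintype.subsetP CS)].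
  by rewrite !inE iF orbT.
by apply/negP => /(fintype.subsetP CS); rewrite !inE eqxx.
Qed.

Lemma hyperplane_lift S : torsion_coker a -> torsion_coker a' ->
  is_hyperplane (real_space R D') (family_span R a' S) ->
  is_hyperplane (real_space R D) (family_span R a (lift_set S)).
Proof.
move=> ta ta' /(hyperplaneP _ _ ta')[nS [xi spS]]; apply/(hyperplaneP _ _ ta).
split; first by move/spans_lift.
have [zeta [zF zJ zE]] := glue xi (fun=> 0); exists zeta => mu.
have [nu [nuF ->]] := off_F_rep mu.
have [lam' [t [lS E]]] := spS (fun u => nu (val u)).
have [lam [lF lJ lE]] := glue lam' nu; exists lam, t.
have lE' : (fun u => lam (val u)) = lam' by apply/funext => u; rewrite lE.
split; first by apply/supp_lift; rewrite // lE'.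
rewrite -rcombZ -rcombD rcomb_quotB //; last first.
  by move=> i iF; rewrite lF // zF // mulr0 addr0.
split; first by move=> j jJ; rewrite lJ // zJ // mulr0 addr0.
rewrite E -rcombZ -rcombD; congr rcomb; apply/funext => u.
by rewrite lE zE.
Qed.

Lemma generic_quot theta : torsion_coker a -> torsion_coker a' ->
  generic R a theta -> generic R a' (phi theta).
Proof.
move=> ta ta' gen S /(hyperplane_lift ta ta') /gen ngen.
move=> /family_spanP[lam' [lS E]]; apply: ngen; apply/family_spanP.
have : real_space R D (bar R theta) by apply: rspan_sub; exists theta.
move/(real_spaceP ta) => [mu thE]; have [nu [nuF nuE]] := off_F_rep mu.
rewrite nuE in thE; have thE' := push_rcomb nuF thE.
(* On [J] the lift copies the coordinates of [theta]; [lift_set S] contains [J], so the support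
   allows it. *)
have [lam [lF lJ lE]] := glue lam' nu; exists lam.
have lE' : (fun u => lam (val u)) = lam' by apply/funext => u; rewrite lE.
split; first by apply/supp_lift; rewrite // lE'.
rewrite thE rcomb_quotB // lE' -E -thE'; split=> // j jJ.
by rewrite lJ.
Qed.

End QuotientArrangement.

(** * Lawrence fans *)

Definition forget (I : Type) (z : I + I) : I :=
  match z with inl i => i | inr i => i end.

(** [z] lies in the complement of [sigma(C, theta)], where [theta] has the
    coordinates [lam]. *)
Definition side (R : realType) (I : Type) (lam : I -> R) (z : I + I) : bool :=
  match z with inl i => lam i <= 0 | inr i => 0 <= lam i end.

Section LawrenceCone.
Variables (R : realType) (A : arrangement R).

Local Notation I := (arr_I A).
Local Notation a := (gale_dual (arr_res A)).

Lemma arr_gale_pair : gale_pair (arr_b A) a.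
Proof. exact: DG_gale_pair. Qed.

Lemma arr_torsion : torsion_coker (arr_b A).
Proof. exact/finite_coker_torsion/arr_finite_coker. Qed.

Lemma arr_dual_torsion : torsion_coker a.
Proof. exact: gale_pair_coker arr_gale_pair. Qed.

Lemma pm_gale_torsion : torsion_coker (pm_gale A).
Proof.
move=> x; have [k k0 [c cE]] := arr_dual_torsion x; exists k => //.
exists (fun z => match z with inl i => c i | inr _ => 0 end).
by rewrite big_sumType /= [X in _ + X]big1 ?addr0 // => i _; rewrite mulr0z.
Qed.

Lemma lawrence_dual_pair (resL : resolution (pm_gale A)) :
  gale_pair (gale_dual resL) (pm_gale A).
Proof. exact: gale_pair_sym pm_gale_torsion (DG_gale_pair resL). Qed.

Definition theta_basis (C : {set I}) (lam : I -> R) :=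
  [/\ lin_indep R a C, spans R a C, supp lam C & bar R (arr_theta A) = rcomb a lam].

Lemma mem_sigma_set (C : {set I}) (lam : I -> R) z :
  (z \in sigma_set C lam) =
  (forget z \in C) && match z with inl i => 0 < lam i | inr i => lam i < 0 end.
Proof.
rewrite finset.in_setU; case: z => i /=.
  apply/orP/idP => [[/imsetP[j jP [->]]|/imsetP[j _ //]]|iP].
    by rewrite inE in jP.
  by left; apply/imsetP; exists i => //; rewrite inE.
apply/orP/idP => [[/imsetP[j _ //]|/imsetP[j jP [->]]]|iP].
  by rewrite inE in jP.
by right; apply/imsetP; exists i => //; rewrite inE.
Qed.

(** Once [lam] is zero off [C], the sign conditions alone describe the complement of
    [sigma_set C lam]: off [C] both copies of an index satisfy them. *)
Lemma lawrence_coneP (resL : resolution (pm_gale A)) (K : {set I + I}) :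
  sf_cone (lawrence_fan resL) K <->
  exists C lam, theta_basis C lam /\ forall z, z \in K -> side lam z.
Proof.
split=> [[_ [C [lam [/(basisP _ _ arr_dual_torsion)[indC spC] thE ->]] KM]]|].
  exists C, (fun i => if i \in C then lam i else 0); split.
    split=> //; first exact: restr_supp.
    by rewrite rcomb_restr.
  move=> z /(fintype.subsetP KM); rewrite finset.in_setC mem_sigma_set.
  by case: z => i /=; case: ifP => //= _; rewrite -leNgt.
move=> [C [lam [[indC spC lC thE] Kside]]]; exists (~: sigma_set C lam)%SET.
  exists C, lam; split=> //; first exact/(basisP _ _ arr_dual_torsion).
  by rewrite thE (rcomb_supp _ lC).
apply/fintype.subsetP => z /Kside; rewrite finset.in_setC mem_sigma_set.
by case: z => i /=; rewrite leNgt => /negPf->; rewrite andbF.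
Qed.

(** A zero coordinate would put [theta] on the hyperplane spanned by the other
    members of the basis. *)
Lemma theta_basis_neq0 C lam i : theta_basis C lam -> i \in C -> lam i != 0.
Proof.
move=> [indC spC lC thE] iC; apply/eqP => li0.
pose S := (C :\ i)%SET.
have lS : supp lam S.
  by move=> j; rewrite !inE negb_and negbK => /orP[/eqP->//|/lC].
apply: (@arr_generic R A S); last by apply/family_spanP; exists lam.
apply/(hyperplaneP _ _ arr_dual_torsion); split.
  move=> spS; have [mu [mS E]] := spS (fun j => (j == i)%:R).
  have /lin_indepP/(_ (fun j => (j == i)%:R - mu j)) := indC.
  have S_i : i \notin S by rewrite !inE eqxx.
  move=> /(_ _ _ i); rewrite eqxx mS // subr0 => one0.
  suff : (1 : R) = 0 by move/eqP; rewrite oner_eq0.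
  apply: one0; last exact/rcomb_eq0B.
  move=> j jC; rewrite mS ?inE ?(negPf jC) ?andbF // subr0.
  by rewrite (_ : j == i = false) //; apply: contraNF jC => /eqP->.
exists (fun j => (j == i)%:R) => mu; have [nu [nC ->]] := spC mu.
exists (fun j => nu j - nu i * (j == i)%:R), (nu i); split.
  move=> j; rewrite !inE negb_and negbK => /orP[/eqP->|jC].
    by rewrite eqxx mulr1 subrr.
  rewrite (nC _ jC) sub0r (_ : j == i = false) ?mulr0 ?oppr0 //.
  by apply: contraNF jC => /eqP->.
by rewrite rcombB rcombZ subrK.
Qed.

(** A relation on [K] is a functional [g] on [D] vanishing at [pm_gale A z] for [z] outside [K]. For
    [i \in C] the coordinate of [theta] is nonzero, so [K] misses one copy of [i] and [g (a i) = 0];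
    as [C] spans, [g] kills every [a i]. *)
Lemma lawrence_int_indep (resL : resolution (pm_gale A)) (K : {set I + I}) :
  sf_cone (lawrence_fan resL) K -> int_indep (gale_dual resL) K.
Proof.
move=> /lawrence_coneP[C [lam [thC Kside]]] c c0.
pose c' z := if z \in K then c z else 0.
have /(gale_pair_relP c' (lawrence_dual_pair resL))[g gE] :
    \sum_z gale_dual resL z *~ c' z = 0.
  rewrite -[RHS]c0 [RHS]big_mkcond; apply: eq_bigr => z _.
  by rewrite /c'; case: ifP; rewrite ?mulr0z.
have gC i : i \in C -> g (a i) = 0.
  move=> /(theta_basis_neq0 thC) li0.
  have : inl i \notin K \/ inr i \notin K.
    have [lK|] := boolP (inl i \in K); last by left.
    right; apply/negP => rK; have := Kside _ lK; have /= := Kside _ rK => l1 l2.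
    by move/eqP: li0; apply; apply/eqP; rewrite eq_le l1 l2.
  case=> /negPf iK; first by rewrite (gE (inl i)) /c' iK.
  by apply/eqP; rewrite -oppr_eq0 -raddfN (gE (inr i)) /c' iK.
have g0 i : g (a i) = 0.
  have [_ spC _ _] := thC; have [mu [mC]] := spC (fun j => (j == i)%:R).
  rewrite rcomb_delta => /(congr1 (fun v => v g)); rewrite rcombE big1.
    by rewrite /bar => /eqP; rewrite intr_eq0 => /eqP.
  move=> j _; have [/gC->|/mC->] := boolP (j \in C); rewrite ?mul0r //.
  by rewrite mulr0.
move=> z zK; have := gE z; rewrite /c' zK => <-.
by case: z {zK} => i /=; rewrite ?raddfN g0 ?oppr0.
Qed.

End LawrenceCone.

(** An [arrangement] stores [theta] in the [DG] of a chosen resolution, so the quotient of [D] is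
    carried over to such a group by [gale_pair_iso]. *)
Lemma quotient_dual (R : realType) (I : finType) (N D : zmodType) (b : I -> N)
    (a : I -> D) (F : {set I}) : gale_pair b a -> lin_indep R b F ->
  exists (res' : resolution (@quot_b R I N b F)) (phi : {additive D -> DG res'}),
  [/\ forall u, phi (a (val u)) = gale_dual res' u, forall y, exists x, phi x = y &
      forall x, phi x = 0 <-> exists c : I -> int,
        x = \sum_(i in ~: (F :|: mf_link R b F)%SET) a i *~ c i].
Proof.
move=> ba indF; pose J := (~: (F :|: mf_link R b F))%SET.
have pairE : gale_pair (@quot_b R I N b F) (fun u => to_quotg a J (a (val u))).
  apply: (gale_pair_quot (q := to_quotg b F) (phi := to_quotg a J) ba).
  - exact: link_disjoint.
  - exact: lin_indep_int indF.
  - exact: to_quotg_surj.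
  - exact: to_quotg_eq0.
  - exact: to_quotg_surj.
  - exact: to_quotg_eq0.
have [res'] := gale_pair_resolution (@quot_b R I N b F) pairE.
have [f [g [fK gK fE gE]]] := gale_pair_iso pairE (DG_gale_pair res').
exists res', (f \o to_quotg a J : {additive _ -> _}); split=> [u|y|x] /=.
- exact: fE.
- by have [x xE] := to_quotg_surj (g y); exists x; rewrite xE gK.
rewrite -to_quotg_eq0; split=> [fx0|->]; last exact: raddf0.
by rewrite -[LHS]fK fx0 raddf0.
Qed.

Lemma mem_pm_imset (I : finType) (S : {set I}) (z : I + I) :
  (z \in ((inl @: S) :|: (inr @: S))%SET) = (forget z \in S).
Proof.
rewrite finset.in_setU; case: z => i; apply/orP/idP => /=.
- by case=> /imsetP[j jS // [->]].
- by left; apply/imsetP; exists i.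
- by case=> /imsetP[j jS // [->]].
by right; apply/imsetP; exists i.
Qed.

Definition lift_pair (I : Type) (P : pred I) (w : {i | P i} + {i | P i}) : I + I :=
  match w with inl u => inl (val u) | inr u => inr (val u) end.

Lemma lift_pair_inj (I : Type) (P : pred I) : injective (@lift_pair I P).
Proof. by case=> u [] w //= [] /val_inj->. Qed.

(** * The quotient fan as a Lawrence fan *)

Section QuotientLawrence.
Variables (R : realType) (A : arrangement R) (resL : resolution (pm_gale A)).
Variables (F : {set arr_I A}) (T : {set arr_I A + arr_I A}).

Local Notation b := (arr_b A).
Local Notation a := (gale_dual (arr_res A)).
Local Notation L := (mf_link R b F).
Local Notation J := (~: (F :|: L))%SET.
Local Notation sigma := ((inl @: F) :|: (inr @: F) :|: T)%SET.

Hypotheses (indF : lin_indep R b F) (T_sub : T \subset ((inl @: J) :|: (inr @: J))%SET).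
Hypothesis T_card : #|T| = (#|arr_I A| - #|L| - #|F|)%N.
Hypothesis sigma_cone : sf_cone (lawrence_fan resL) sigma.

Variables (res' : resolution (@quot_b R _ _ b F)).
Variables (phi : {additive DG (arr_res A) -> DG res'}).
Hypotheses (phi_a : forall u, phi (a (val u)) = gale_dual res' u)
  (phi_ker : forall x, phi x = 0 <-> exists c : arr_I A -> int,
     x = \sum_(i in J) a i *~ c i).

Local Notation a' := (gale_dual res').

Let ba := arr_gale_pair A.
Let ba' := DG_gale_pair res'.

Lemma phi_rest j : j \in J -> phi (a j) = 0.
Proof.
move=> jJ; apply/phi_ker; exists (fun i => (i == j)%:R).
rewrite (bigD1 j) //= eqxx big1 ?addr0 // => i /andP[_ /negPf->].
by rewrite mulr0z.
Qed.

Local Notation quotB := (rcomb_quotB ba indF ba' phi_a phi_rest).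

Lemma mem_sigma z : (z \in sigma) = (forget z \in F) || (z \in T).
Proof. by rewrite finset.in_setU mem_pm_imset. Qed.

Lemma T_rest z : z \in T -> forget z \in J.
Proof. by move/(fintype.subsetP T_sub); rewrite mem_pm_imset. Qed.

(** The data [(C, lam)] of a maximal cone containing [sigma]. *)
Definition coords (C : {set arr_I A}) (lam : arr_I A -> R) :=
  theta_basis C lam /\ forall z, z \in sigma -> side lam z.

(** Both copies of [i \in F] lie in [sigma], which forces [lam i = 0]; genericity excludes this on
    [C]. *)
Lemma coords_disjoint C lam : coords C lam -> [disjoint F & C].
Proof.
move=> [thC lam_side]; apply/pred0P => i /=; apply/negP => /andP[iF].
move=> /(theta_basis_neq0 thC)/eqP; apply; apply/eqP; rewrite eq_le.
have := lam_side (inl i); have := lam_side (inr i).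
by rewrite !mem_sigma iF /= => /(_ isT) -> /(_ isT) ->.
Qed.

Lemma coords_off_F C lam : coords C lam -> off_F F lam.
Proof.
by move=> co; have [[_ _ lC _] _] := co; apply: supp_off_F (coords_disjoint co) lC.
Qed.

Lemma coords_rest_neq0 C lam j : coords C lam -> j \in J -> lam j != 0.
Proof.
move=> co jJ; have [thC _] := co; apply: (theta_basis_neq0 thC).
have [_ spC _ _] := thC.
exact: (fintype.subsetP (spans_rest ba indF ba' phi_a phi_rest (coords_disjoint co) spC)).
Qed.

(** As [T] has [#|J|] elements, it contains exactly one of [j] and [j']. *)
Lemma mem_T C lam z : coords C lam -> forget z \in J -> (z \in T) = side lam z.
Proof.
move=> co zJ; have [_ lam_side] := co.
have sideT w : w \in T -> side lam w.
  by move=> wT; apply: lam_side; rewrite mem_sigma wT orbT.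
have side_inj w w' : forget w = forget w' -> forget w \in J ->
    side lam w -> side lam w' -> w = w'.
  move=> ww' wJ; have := coords_rest_neq0 co wJ.
  case: w w' ww' {wJ} => i [] i' /= <- // /negP n0 l1 l2; case: n0;
    by rewrite eq_le l1 l2.
have cardJ : #|J| = #|T|.
  rewrite T_card cardsCs finset.setCK cardsU.
  rewrite (_ : F :&: L = finset.set0)%SET ?cards0 ?subn0.
    by rewrite subnDA subnAC.
  by apply/eqP; rewrite finset.setI_eq0; apply: link_disjoint.
have imT : (@forget _ @: T = J)%SET.
  apply/eqP; rewrite eqEcard cardJ card_in_imset ?leqnn ?andbT.
    by apply/fintype.subsetP => _ /imsetP[w wT ->]; apply: T_rest.
  by move=> w w' wT w'T ww'; apply: (side_inj _ _ ww'); rewrite ?T_rest ?sideT.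
apply/idP/idP => [/sideT //|zs]; move: (zJ); rewrite -imT => /imsetP[w wT zw].
by rewrite (side_inj z w) // sideT.
Qed.

Lemma coords_exist : exists C lam, coords C lam.
Proof. by have /lawrence_coneP[C [lam [thC lS]]] := sigma_cone; exists C, lam. Qed.

Lemma quot_finite_coker : finite_coker (@quot_b R _ _ b F).
Proof.
have := resolution_presents res'; case=> gen _ _ _.
exact: (torsion_finite_coker gen (quot_b_torsion_coker ba (@arr_torsion R A) indF)).
Qed.

Definition quot_arr : arrangement R :=
  @Arrangement R (quotg b F) _ (@quot_b R _ _ b F) res' (phi (arr_theta A))
    quot_finite_coker (@quot_b_nontorsion R _ _ b F)
    (generic_quot ba indF ba' phi_a phi_rest (@arr_dual_torsion R A)
       (gale_pair_coker ba') (@arr_generic R A)).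

Lemma quot_cone (resL' : resolution (pm_gale quot_arr))
    (K : {set arr_I quot_arr + arr_I quot_arr}) :
  sf_cone (lawrence_fan resL) (sigma :|: (@lift_pair _ _ @: K))%SET <->
  sf_cone (lawrence_fan resL') K.
Proof.
split=> /lawrence_coneP[C [lam [thC lamK]]]; apply/lawrence_coneP.
  have co : coords C lam.
    by split=> // z zs; apply: lamK; rewrite finset.in_setU zs.
  have lF := coords_off_F co; have dFC := coords_disjoint co.
  have [indC spC lC thE] := thC.
  have JC := spans_rest ba indF ba' phi_a phi_rest dFC spC.
  have CE := lift_quot_set dFC JC.
  exists (quot_set R b F C), (fun u => lam (val u)); split.
    split.
    - by apply/(lin_indep_lift ba indF ba' phi_a phi_rest); rewrite CE.
    - by apply/(spans_lift ba indF ba' phi_a phi_rest); rewrite CE.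
    - by apply/(supp_lift _ lF); rewrite CE.
    exact: (push_rcomb phi_a phi_rest lF thE).
  move=> w wK; have : side lam (lift_pair w).
    by apply: lamK; rewrite finset.in_setU imset_f ?orbT.
  by case: w {wK}.
have [C0 [lam0 co0]] := coords_exist.
have [indC spC lC thE] := thC.
(* The coordinates at [J] come from a maximal cone known to contain [sigma]. They are the right ones
   for [theta], and [T] satisfies their sign conditions. *)
have [nu [nuF nuJ nuE]] := glue (F := F) lam lam0.
have nuE' : (fun u => nu (val u)) = lam by apply/funext => u; rewrite nuE.
exists (lift_set C), nu; split.
  split.
  - exact/(lin_indep_lift ba indF ba' phi_a phi_rest).
  - exact/(spans_lift ba indF ba' phi_a phi_rest).
  - by apply/supp_lift; rewrite ?nuE'.
  have [[_ _ _ thE0] _] := co0; rewrite thE0.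
  have l0F := coords_off_F co0; apply/(quotB l0F nuF).
  split=> [j jJ|]; first by rewrite nuJ.
  by rewrite nuE' -(push_rcomb phi_a phi_rest l0F thE0).
move=> z; rewrite finset.in_setU mem_sigma => /orP[/orP[zF|zT]|/imsetP[w wK ->]].
- by case: z zF => i /= iF; rewrite nuF.
- have zJ := T_rest zT; move: zT; rewrite (mem_T co0 zJ).
  by case: z zJ => i /= iJ; rewrite nuJ.
by have := lamK w wK; case: w {wK} => u /=; rewrite nuE.
Qed.

(** Over [J], a [z] compatible with [sigma] satisfies the sign condition and is already in [T]. Over
    [L], a basis avoiding [F] and the index gives [theta] a zero coordinate there, which admits both
    copies. *)
Lemma mem_link_rays z :
  (z \in @link_rays (lawrence_fan resL) sigma) = (forget z \in L).
Proof.
rewrite inE; apply/asboolP/idP => [[]|zL].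
  move=> /lawrence_coneP[C [lam [thC lamK]]].
  rewrite disjoint_sym disjoints1 mem_sigma negb_or.
  case/andP=> zF zT; have co : coords C lam.
    by split=> // w ws; apply: lamK; rewrite finset.in_setU ws.
  case: (link_trichotomy R b F (forget z)) => [|//|zJ]; first by rewrite (negPf zF).
  case/negP: zT; rewrite (mem_T co zJ); apply: lamK.
  by rewrite finset.in_setU finset.in_set1 eqxx orbT.
have [C0 [lam0 co0]] := coords_exist.
have zF := link_notin_F zL.
have zT : z \notin T.
  by apply/negP => /T_rest; rewrite restE zL andbF.
split; last by rewrite disjoint_sym disjoints1 mem_sigma negb_or zF.
have [C [dFC zC indC spC]] := basis_avoiding ba (exist (fun i => i \in L) _ zL).
have [[_ _ _ thE0] _] := co0; have l0F := coords_off_F co0.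
have [lam [lC E]] := spC lam0; have lF := supp_off_F dFC lC.
have [lJ _] := (quotB l0F lF).1 E.
apply/lawrence_coneP; exists C, lam; split; first by split=> //; rewrite thE0.
move=> w; rewrite finset.in_setU mem_sigma finset.in_set1 => /orP[/orP[wF|wT]|/eqP->].
- by case: w wF => i /= iF; rewrite lF.
- have wJ := T_rest wT; move: wT; rewrite (mem_T co0 wJ).
  by case: w wJ => i /= iJ; rewrite lJ.
by case: z zL zF zT zC => i /= *; rewrite lC.
Qed.

Lemma pm_quot w : phi (pm_gale A (lift_pair w)) = pm_gale quot_arr w.
Proof. by case: w => u /=; rewrite ?raddfN phi_a. Qed.

(** Outside [sigma] and its link remains exactly one copy of each [j \in J], the one not in [T]. Up
    to sign these give the generators [a j] of the kernel of [phi]. *)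
Lemma phi_ker_pm x : phi x = 0 <-> exists c : arr_I A + arr_I A -> int,
  x = \sum_(z in ~: (sigma :|: @link_rays (lawrence_fan resL) sigma)%SET)
        pm_gale A z *~ c z.
Proof.
have [C0 [lam0 co0]] := coords_exist.
have memE z : (z \in ~: (sigma :|: @link_rays (lawrence_fan resL) sigma)%SET) =
    (forget z \in J) && ~~ side lam0 z.
  rewrite restE finset.in_setC finset.in_setU mem_sigma mem_link_rays !negb_or.
  have [zJ|] := boolP (forget z \in J).
    by rewrite (mem_T co0 zJ); move: zJ; rewrite restE => /andP[-> ->]; rewrite andbT.
  rewrite restE negb_and => /orP[]; first by move/negPf->.
  by move/negPf->; rewrite !andbF.
split=> [/phi_ker[c ->]|[c ->]].
  exists (fun z => match z with inl i => c i | inr i => - c i end).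
  rewrite big_mkcond [RHS]big_mkcond big_sumType /= -big_split; apply: eq_bigr => i _ /=.
  rewrite !memE /=; case: (boolP (i \in J)) => [iJ|_] /=; last by rewrite addr0.
  have := coords_rest_neq0 co0 iJ; rewrite -!ltNge neq_lt => /orP[l0|l0].
    by rewrite l0 (lt_gtF l0) add0r mulNrz mulrNz opprK.
  by rewrite l0 (lt_gtF l0) addr0.
rewrite raddf_sum_mulrz big1 // => z; rewrite memE => /andP[zJ _].
by case: z zJ => i /= iJ; rewrite ?raddfN phi_rest // ?oppr0 mul0rz.
Qed.

End QuotientLawrence.

Theorem proposition3p5 (R : realType) (A : arrangement R)
    (resL : resolution (pm_gale A))
    (v1 v2 v3 : arr_N A) (F1 F2 F3 F : {set arr_I A}) (n : arr_I A -> nat)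
    (T sigma_theta : {set arr_I A + arr_I A})
    (res : resolution
             (sf_b (quotient_fan (Sg := lawrence_fan resL) sigma_theta))) :
  in_box R (arr_b A) v1 F1 ->
  in_box R (arr_b A) v2 F2 ->
  in_box R (arr_b A) v3 F3 ->
  mf_minimal R (arr_b A) F1 F2 F3 F ->
  (forall i, i \in F -> n i = 1%N \/ n i = 2%N) ->
  bar R v1 + bar R v2 + bar R v3 =
    \sum_(i in F) (n i)%:R *: bar R (arr_b A i) ->
  let L := mf_link R (arr_b A) F in
  let J := (~: (F :|: L))%SET in
  T \subset ((inl @: J) :|: (inr @: J))%SET ->
  #|T| = (#|arr_I A| - #|L| - #|F|)%N ->
  sigma_theta = ((inl @: F) :|: (inr @: F) :|: T)%SET ->
  sf_cone (lawrence_fan resL) sigma_theta ->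
  is_lawrence_stack (toric_stack R res).
Proof.
move=> _ _ _ [[indF _ _ _] _] _ _ L J T_sub T_card sigmaE.
rewrite {}sigmaE in res *; set sigma := (_ :|: T)%SET in res * => sigma_cone.
have [res' [phi [phi_a phi_surj phi_ker]]] :=
  quotient_dual (arr_gale_pair A) indF.
pose A' := quot_arr indF phi_a phi_ker.
have raysE := mem_link_rays indF T_sub T_card sigma_cone phi_a phi_ker.
have [resL'] := gale_pair_resolution (pm_gale A')
  (gale_pair_sym (@arr_torsion R A') (arr_gale_pair A')).
have [resX] := gale_pair_resolution (gale_dual resL') (lawrence_dual_pair resL').
exists A', resL', resX.
have disj : [disjoint sigma & @link_rays (lawrence_fan resL) sigma].
  apply/pred0P => z /=; apply/negP => /andP[zs]; rewrite raysE => zL.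
  move: zs; rewrite mem_sigma (negPf (link_notin_F zL)) /= => /(T_rest T_sub).
  by rewrite restE zL andbF.
(* Both fans have [DG res'] as a Gale dual, the quotient fan through [phi] and the Lawrence fan of
   [A'] by biduality. The maps [f] and [g] link it to the duals given by [res] and [resX]. *)
have pair1 := gale_pair_quot (lawrence_dual_pair resL) disj
  (lawrence_int_indep sigma_cone) (@to_quotg_surj _ _ (gale_dual resL) sigma)
  (@to_quotg_eq0 _ _ (gale_dual resL) sigma) phi_surj
  (phi_ker_pm indF T_sub T_card sigma_cone phi_a phi_ker).
have [f [f' [fK f'K fE _]]] := gale_pair_iso (DG_gale_pair res) pair1.
have [g [g' [gK g'K gE _]]] :=
  gale_pair_iso (lawrence_dual_pair resL') (DG_gale_pair resX).
(* The rays of the quotient fan form a subtype of a sum, those of the new Lawrence fan a sum of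
   subtypes; [lift_pair] matches them. *)
have exh (w : @link_index (lawrence_fan resL) sigma) :
    exists w' : arr_I A' + arr_I A', lift_pair w' = val w.
  case: w => -[i|i] /= iL; have := iL; rewrite raysE => iL'.
    by exists (inl (exist _ i iL')).
  by exists (inr (exist _ i iL')).
have exk (w' : arr_I A' + arr_I A') :
    exists w : @link_index (lawrence_fan resL) sigma, val w = lift_pair w'.
  have w'r : lift_pair w' \in @link_rays (lawrence_fan resL) sigma.
    by rewrite raysE; case: w' => u; apply: valP.
  by exists (exist (fun z => z \in @link_rays (lawrence_fan resL) sigma) _ w'r).
have [h hE] := choice exh; have [k kE] := choice exk.
have hK : cancel h k by move=> w; apply: val_inj; rewrite kE hE.
have kK : cancel k h by move=> w; apply: lift_pair_inj; rewrite hE kE.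
apply: (@stack_iso_gale R (@quotient_fan (lawrence_fan resL) sigma)
  (lawrence_fan resL') res resX (g \o f : {additive _ -> _})
  (f' \o g' : {additive _ -> _}) h k) => //.
- exact: can_comp.
- exact: can_comp.
- by move=> w /=; rewrite fE -hE pm_quot gE.
move=> K; rewrite -(quot_cone T_sub T_card sigma_cone resL').
rewrite -imset_comp.
have -> // : ((@lift_pair _ _ \o h) @: K)%SET = (val @: K)%SET.
by apply: eq_imset => w; exact: hE.
Qed.
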